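(* Let $p\in(2,6)$ and $\beta=\frac{p-2}{6-p}$. There exists $\varepsilon>0$, depending only on $p$, with the following property. If $\mu>0$ and $\mathcal{G}$ is a metric graph consisting of exactly one half-line attached to a compact core $\mathcal{K}$ satisfying $$\max\Big\{\mu^\beta\,\mathrm{diam}(\mathcal{K}),\ \frac{1}{\mu^\beta|\mathcal{K}|}\Big\}<\varepsilon,$$ then $\mathcal{G}$ has no ground state of mass $\mu$.
   Context: A metric graph $\mathcal{G}$ is a connected graph with finitely many edges, each identified with a bounded interval $[0,\ell_e]$ or a half-line $[0,+\infty)$ (attached at $0$), glued at vertices, with the shortest-path distance. The compact core $\mathcal{K}$ of $\mathcal{G}$ is the metric graph obtained by removing every half-line (as a metric space: removing the interiors of the half-lines). $|\mathcal{K}|$ is the total length of $\mathcal{K}$ (sum of its edge lengths) and $\mathrm{diam}(\mathcal{K})$ its diameter. $H^1(\mathcal{G})$ consists of real continuous functions on $\mathcal{G}$ which are $H^1$ on each edge with finite $H^1$ norm; $E(u,\mathcal{G})=\frac12\int_{\mathcal{G}}|u'|^2-\frac1p\int_{\mathcal{G}}|u|^p$; $H^1_\mu(\mathcal{G})=\{u\in H^1(\mathcal{G}):\|u\|_{L^2}^2=\mu\}$; a ground state of mass $\mu$ is a minimizer of $E(\cdot,\mathcal{G})$ on $H^1_\mu(\mathcal{G})$. *)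

(* Defs.v *)
From HB Require Import structures.
From mathcomp Require Import all_boot all_order all_algebra.
From mathcomp Require Import all_classical all_reals all_analysis.
Set Implicit Arguments. Unset Strict Implicit. Unset Printing Implicit Defensive.
Import Order.TTheory GRing.Theory Num.Theory.
Import numFieldNormedType.Exports.
Local Open Scope classical_set_scope.
Local Open Scope ring_scope.

(* Metric graphs with a compact core and exactly ONE half-line.       *)
(* Vertices are 'I_nv, bounded edges are 'I_ne; bounded edge e is     *)
(* identified with [0, elen G e], its point 0 glued to vertex esrc G e    *)
(* and its point elen G e glued to vertex edst G e (loops and multiple    *)
(* edges allowed). The single half-line [0,+oo) is attached at its    *)
(* point 0 to the vertex hv.                                          *)
Record mgraph (R : realType) := MGraph {
  nv : nat;
  ne : nat;
  esrc : 'I_ne -> 'I_nv;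
  edst : 'I_ne -> 'I_nv;
  elen : 'I_ne -> R;
  hv : 'I_nv
}.
Arguments esrc {R} _ _.
Arguments edst {R} _ _.
Arguments elen {R} _ _.
Arguments hv {R} _.

Section MetricGraph.
Variable R : realType.
Variable G : mgraph R.

Fixpoint walk (a : 'I_(nv G)) (s : seq 'I_(ne G)) (b : 'I_(nv G)) : bool :=
  match s with
  | [::] => a == b
  | e :: s' => ((esrc G e == a) && walk (edst G e) s' b)
               || ((edst G e == a) && walk (esrc G e) s' b)
  end.

Definition walk_length (s : seq 'I_(ne G)) : R := \sum_(e <- s) elen G e.

(* connectedness of G (the half-line is attached to a vertex, so G is
   connected iff the vertices are connected through bounded edges) *)
Definition connected_graph : Prop :=
  forall a b : 'I_(nv G), exists s, walk a s b.

Definition valid_graph : Prop :=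
  (forall e, 0 < elen G e) /\ connected_graph.

Definition core_length : R := \sum_(e < ne G) elen G e.

Definition vdist (a b : 'I_(nv G)) : R :=
  inf [set walk_length s | s in [set s | walk a s b]].

Definition kpoint (x : 'I_(ne G) * R) : Prop := 0 <= x.2 <= elen G x.1.

Definition kdist (x y : 'I_(ne G) * R) : R :=
  let ends (z : 'I_(ne G) * R) := [:: (esrc G z.1, z.2); (edst G z.1, elen G z.1 - z.2)] in
  let via := [seq a.2 + vdist a.1 b.1 + b.2 | a <- ends x, b <- ends y] in
  let cands := if x.1 == y.1 then `|x.2 - y.2| :: via else via in
  \big[Order.min/(head 0 cands)]_(c <- cands) c.

Definition core_diam : R :=
  sup [set d | exists x y, [/\ kpoint x, kpoint y & d = kdist x y]].

(* H^1(G): a function given edgewise together with its weak derivative *)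
Record gfun := GFun {
  fe : 'I_(ne G) -> R -> R;   (* u on bounded edge e, on [0, elen G e] *)
  de : 'I_(ne G) -> R -> R;   (* its weak derivative u' on edge e    *)
  fh : R -> R;                (* u on the half-line [0, +oo)          *)
  dh : R -> R                 (* its weak derivative on the half-line *)
}.

Definition leb := @lebesgue_measure R.
Definition seg (l : R) : set R := `[0, l].
Definition hl : set R := `[0, +oo[.

(* H^1 on [0,l]: u(x) = u(0) + \int_0^x g with g in L^2(0,l)
   (the continuous representative of an H^1 function on an interval) *)
Definition H1_interval (l : R) (u g : R -> R) : Prop :=
  measurable_fun (seg l) g /\
  (\int[leb]_(x in seg l) ((g x) ^+ 2)%:E < +oo)%E /\
  forall x, 0 <= x <= l -> u x = u 0 + Rintegral leb (seg x) g.

Definition H1_halfline (u g : R -> R) : Prop :=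
  measurable_fun hl u /\ measurable_fun hl g /\
  (\int[leb]_(x in hl) ((u x) ^+ 2)%:E < +oo)%E /\
  (\int[leb]_(x in hl) ((g x) ^+ 2)%:E < +oo)%E /\
  forall x, 0 <= x -> u x = u 0 + Rintegral leb (seg x) g.

Definition vertex_continuous (u : gfun) : Prop :=
  exists phi : 'I_(nv G) -> R,
    (forall e, fe u e 0 = phi (esrc G e) /\ fe u e (elen G e) = phi (edst G e)) /\
    fh u 0 = phi (hv G).

Definition inH1 (u : gfun) : Prop :=
  vertex_continuous u /\
  (forall e, H1_interval (elen G e) (fe u e) (de u e)) /\
  H1_halfline (fh u) (dh u).

Definition gint (F : R -> R) (f : 'I_(ne G) -> R -> R) (fhl : R -> R) : R :=
  \sum_(e < ne G) fine (\int[leb]_(x in seg (elen G e)) (F (f e x))%:E)%E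
  + fine (\int[leb]_(x in hl) (F (fhl x))%:E)%E.

Definition mass (u : gfun) : R := gint (fun t => t ^+ 2) (fe u) (fh u).

Definition energy (p : R) (u : gfun) : R :=
  2^-1 * gint (fun t => t ^+ 2) (de u) (dh u)
  - p^-1 * gint (fun t => `|t| `^ p) (fe u) (fh u).

Definition inH1_mass (mu : R) (u : gfun) : Prop := inH1 u /\ mass u = mu.

Definition ground_state (p mu : R) (u : gfun) : Prop :=
  inH1_mass mu u /\ forall v, inH1_mass mu v -> energy p u <= energy p v.

Definition has_ground_state (p mu : R) : Prop := exists u, ground_state p mu u.

End MetricGraph.

Definition beta (R : realType) (p : R) : R := (p - 2) / (6 - p).

(* Main.v *)
Require Import Defs.
From HB Require Import structures.
From mathcomp Require Import all_boot all_order all_algebra.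
From mathcomp Require Import all_classical all_reals all_analysis.
From mathcomp Require Import measurable_realfun ring lra.
Set Implicit Arguments. Unset Strict Implicit. Unset Printing Implicit Defensive.
Import Order.TTheory GRing.Theory Num.Theory.
Import numFieldNormedType.Exports.
Local Open Scope classical_set_scope.
Local Open Scope ring_scope.

(** Idea.  Write [s = mu^beta] and [q = p - 2], and let [u] be a ground state.
    Extending by zero to the core every function of the half-line that vanishes
    at its origin gives admissible competitors, so that a tent of width of order
    [1/s] yields [E(u) <= - c mu s^2], while the Gagliardo-Nirenberg inequality
    [|u|^2 <= 4 sqrt (mu |u'|^2)] on the graph bounds the kinetic energy by
    [C mu s^2].

    Now delete from [u] everything on the core, push the rest along the
    half-line by [L = 1/s], join it to [0] by an affine ramp and rescale the
    amplitude to recover the mass [mu].  As [E(u)] is minimal, the mass [m_K]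
    and the kinetic energy [k_K] removed satisfy
    [c s^2 m_K + k_K / 2 <= P_K / p + C s u(0)^2].  A small diameter makes [u]
    nearly constant on the core and a large length makes this constant small:
    [P_K] is at most a small multiple of [s^2 m_K], and [s u(0)^2] is at most
    [18 eps (s^2 m_K + k_K)].  Hence [m_K = k_K = 0] and [u(0) = 0].

    Finally, if [u] vanishes on the core and on [[0, a]], the same surgery at
    [a + b], with a ramp of length [2 b], shows that [u] vanishes on
    [[0, a + b]] for a [b > 0] independent of [a].  So [u = 0], contradicting
    [mu > 0].  No symmetrization, soliton or Euler-Lagrange equation is used. *)

(** * Lebesgue integrals of real functions on intervals *)

Section Translation.
Variable R : realType.
Notation mu := (@lebesgue_measure R).

Lemma measurable_shiftr (c : R) : measurable_fun setT (fun x : R => x + c).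
Proof. by apply: measurable_funD => //; exact: measurable_cst. Qed.

Lemma measurable_fun_shift (D E : set R) (f : R -> R) (c : R) :
  measurable D -> measurable E -> (forall x, E x -> D (x + c)) ->
  measurable_fun D f -> measurable_fun E (fun x => f (x + c)).
Proof.
move=> mD mE ED mf.
apply: (@measurable_comp _ _ _ _ _ _ D f E (fun x => x + c)) => //.
  by move=> _ [x Ex <-]; exact: ED.
exact: (measurable_funS measurableT _ (measurable_shiftr c)).
Qed.

(** Lebesgue measure is the only measure giving each []a, b]] its length, and a translation
    preserves these lengths. *)
Lemma pushforward_shiftr (c : R) (A : set R) : measurable A ->
  pushforward mu (fun x : R => x + c : measurableTypeR R) A = mu A.
Proof.
move=> mA; apply/esym/lebesgue_measure_unique => //=.
  exact: measurable_shiftr.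
move=> _ X [[a b] _ <-].
rewrite /pushforward/=.
have -> : (fun x : R => x + c) @^-1` `]a, b] = `]a - c, b - c]%classic.
  by apply/seteqP; split => x /=; rewrite !in_itv/= ltrBlDr lerBrDr.
rewrite !lebesgue_measure_itv/= !lte_fin ltrD2r; case: ifP => // _.
by rewrite -!EFinB; congr (_%:E); ring.
Qed.

Lemma Rintegral_shiftr (c : R) (D : set R) (f : R -> R) :
  measurable D -> mu.-integrable D (EFin \o f) ->
  mu.-integrable ((fun x => x + c) @^-1` D) (EFin \o (fun x => f (x + c))) /\
  \int[mu]_(x in (fun x => x + c) @^-1` D) f (x + c) = \int[mu]_(x in D) f x.
Proof.
move=> mD intf.
pose phi := (fun x => x + c) : measurableTypeR R -> measurableTypeR R.
have mphi : measurable_fun setT phi := measurable_shiftr c.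
(* Extending [f] by zero outside [D] puts the change of variables on the whole line, where the
   preimage of the domain is trivial. *)
pose F := (EFin \o f) \_ D.
have mF : measurable_fun setT F.
  have /integrableP[mf _] := intf; exact: (measurable_restrictT _ mD).1.
have mD' : measurable ((fun x => x + c) @^-1` D).
  by rewrite -[X in measurable X]setTI; exact: mphi.
have eqF : F \o (fun x => x + c) =
    (EFin \o (fun x => f (x + c))) \_ ((fun x => x + c) @^-1` D).
  by apply/funext => x; rewrite /F /= !patchE.
have iF : mu.-integrable setT (F \o (fun x => x + c)).
  apply/integrableP; split; first exact: measurableT_comp.
  have := @ge0_integral_pushforward _ _ _ _ R phi mphi mu setT (abse \o F).
  rewrite preimage_setT => /(_ measurableT) H.
  rewrite -[ltLHS]H; first last.
  - by move=> y _ /=.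
  - exact: measurableT_comp.
  rewrite (eq_measure_integral mu); last first.
    by move=> A mA _; exact: pushforward_shiftr.
  by move: intf; rewrite integrable_mkcond// => /integrableP[].
split.
  by rewrite integrable_mkcond// -eqF.
rewrite /Rintegral; congr fine.
transitivity (\int[mu]_x (F \o phi) x)%E.
  by rewrite integral_mkcond -eqF.
transitivity (\int[mu]_x F x)%E; last by rewrite [RHS]integral_mkcond.
have := @integral_pushforward _ _ _ _ R phi mphi mu setT F mF.
rewrite preimage_setT => /(_ iF measurableT) <-.
apply: eq_measure_integral => A mA _; exact: pushforward_shiftr.
Qed.

End Translation.

Section IntervalIntegrals.
Variable R : realType.
Notation mu := (@lebesgue_measure R).
Implicit Types (D E : set R) (f g u : R -> R).

Lemma integrable_le D f g : measurable D -> measurable_fun D f ->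
  (forall x, D x -> `|f x| <= g x) -> mu.-integrable D (EFin \o g) ->
  mu.-integrable D (EFin \o f).
Proof.
move=> mD mf fg; apply: le_integrable => //; first exact/measurable_EFinP.
by move=> x Dx /=; rewrite lee_fin (le_trans (fg x Dx))// ler_norm.
Qed.

Lemma integrable_sqr D f : measurable D -> measurable_fun D f ->
  (\int[mu]_(x in D) ((f x) ^+ 2)%:E < +oo)%E ->
  mu.-integrable D (EFin \o (fun x => f x ^+ 2)).
Proof.
move=> mD mf foo; apply/integrableP; split.
  by apply/measurable_EFinP; exact: measurable_funX.
apply: le_lt_trans foo; apply: ge0_le_integral => //.
- by apply/measurableT_comp => //; apply/measurable_EFinP; exact: measurable_funX.
- by apply/measurable_EFinP; exact: measurable_funX.
- by move=> x _ /=; rewrite lee_fin ger0_norm// sqr_ge0.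
Qed.

Lemma integrable_itv_cst (a b k : R) :
  mu.-integrable `[a, b] (EFin \o (fun=> k)).
Proof.
apply: continuous_compact_integrable; first exact: segment_compact.
by apply: continuous_subspaceT => x; exact: cst_continuous.
Qed.

Lemma integrable_itv_of_sqr (x y : R) f : measurable_fun `[x, y] f ->
  mu.-integrable `[x, y] (EFin \o (fun t => f t ^+ 2)) ->
  mu.-integrable `[x, y] (EFin \o f).
Proof.
move=> mf if2; apply: (@integrable_le `[x, y] f (fun t => 1 + f t ^+ 2)) => //.
  move=> t _; rewrite -[f t ^+ 2]ger0_norm ?sqr_ge0// normrX.
  by set z := `|f t|; have := sqr_ge0 (z - 1); have := sqr_ge0 z; nra.
exact: (integrableD _ (integrable_itv_cst x y 1) if2).
Qed.

Lemma Rintegral_itv_cst (a b k : R) : a <= b ->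
  \int[mu]_(_ in `[a, b]) k = k * (b - a).
Proof.
move=> ab; rewrite Rintegral_cst//= lebesgue_measure_itv/= lte_fin.
by move: ab; rewrite le_eqVlt => /predU1P[->|->]; rewrite ?ltxx ?subrr ?mulr0// -EFinB.
Qed.

Lemma Rintegral_split (a b : R) (B : itv_bound R) f : a <= b ->
  (BRight b <= B)%O ->
  mu.-integrable [set` Interval (BLeft a) B] (EFin \o f) ->
  \int[mu]_(x in [set` Interval (BLeft a) B]) f x =
  \int[mu]_(x in `[a, b]) f x + \int[mu]_(x in [set` Interval (BLeft b) B]) f x.
Proof.
move=> ab bB itf.
have ab' : (BLeft a <= BRight b)%O by rewrite bnd_simp.
have := Rintegral_itvB itf ab' bB.
rewrite Rintegral_itv_obnd_cbnd; last first.
  apply: integrableS itf => //.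
  by apply: subset_itvr; rewrite bnd_simp.
move=> <-; ring.
Qed.

Lemma le_Rintegral_set D E f : measurable D -> measurable E -> D `<=` E ->
  (forall x, E x -> 0 <= f x) -> mu.-integrable E (EFin \o f) ->
  \int[mu]_(x in D) f x <= \int[mu]_(x in E) f x.
Proof.
move=> mD mE DE f0 itf; rewrite /Rintegral fine_le//.
- by apply: integrable_fin_num => //; exact: integrableS itf.
- exact: integrable_fin_num.
apply: ge0_subset_integral => //; first by case/integrableP: itf.
Qed.

Lemma integrable_setU D E f : measurable D -> measurable E -> [disjoint D & E] ->
  mu.-integrable D (EFin \o f) -> mu.-integrable E (EFin \o f) ->
  mu.-integrable (D `|` E) (EFin \o f).
Proof.
move=> mD mE DE /integrableP[mfD fD] /integrableP[mfE fE].
have mf : measurable_fun (D `|` E) (EFin \o f) by apply/measurable_funU.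
apply/integrableP; split => //; rewrite ge0_integral_setU//.
  exact: lte_add_pinfty.
exact: measurableT_comp.
Qed.

(** Infinite ends stay in place, so that segments and half-lines are translated by one and the same
    lemma. *)
Definition shiftb (c : R) (B : itv_bound R) :=
  match B with BSide b y => BSide b (y + c) | BInfty b => BInfty R b end.

Lemma in_shiftb (c x : R) (A B : itv_bound R) :
  (x + c \in Interval (shiftb c A) (shiftb c B)) = (x \in Interval A B).
Proof.
by case: A B => [[] a|[]] [[] b|[]]; rewrite !in_itv/= ?lerD2r ?ltrD2r.
Qed.

Lemma shiftbK (c : R) (B : itv_bound R) : shiftb (- c) (shiftb c B) = B.
Proof. by case: B => //= b y; rewrite addrK. Qed.

Lemma Rintegral_shift (c : R) (A B : itv_bound R) f :
  mu.-integrable [set` Interval (shiftb c A) (shiftb c B)] (EFin \o f) ->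
  mu.-integrable [set` Interval A B] (EFin \o (fun x => f (x + c))) /\
  \int[mu]_(x in [set` Interval A B]) f (x + c) =
  \int[mu]_(x in [set` Interval (shiftb c A) (shiftb c B)]) f x.
Proof.
move=> itf; have [] := @Rintegral_shiftr R c _ f _ itf; first by [].
have -> // : (fun x => x + c) @^-1` [set` Interval (shiftb c A) (shiftb c B)] =
   [set` Interval A B].
by apply/seteqP; split => x; rewrite /= in_shiftb.
Qed.

(** The second piece is read in its own coordinate, starting at 0. All competitors are assembled
    from such pieces. *)
Definition glueat {T} (a : R) (f1 f2 : R -> T) (x : R) : T :=
  if x <= a then f1 x else f2 (x - a).

Lemma Rintegral_glue (a : R) (B : itv_bound R) f1 f2 : 0 <= a ->
  (BRight 0 <= B)%O ->
  mu.-integrable `[0, a] (EFin \o f1) ->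
  mu.-integrable [set` Interval (BLeft 0) B] (EFin \o f2) ->
  mu.-integrable [set` Interval (BLeft 0) (shiftb a B)] (EFin \o glueat a f1 f2) /\
  \int[mu]_(x in [set` Interval (BLeft 0) (shiftb a B)]) glueat a f1 f2 x =
  \int[mu]_(x in `[0, a]) f1 x + \int[mu]_(x in [set` Interval (BLeft 0) B]) f2 x.
Proof.
move=> a0 B0 if1 if2.
have aB : (BRight a <= shiftb a B)%O.
  by move: B0; case: (B) => [[] b|[]]; rewrite /shiftb !bnd_simp// -?lerBlDr ?subrr -?ltrBlDr ?subrr.
have if2' : mu.-integrable [set` Interval (BRight 0) B] (EFin \o f2).
  by apply: integrableS if2 => //; apply: subset_itvr; rewrite bnd_simp.
have [] := @Rintegral_shift (- a) (BRight a) (shiftb a B) f2.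
  by rewrite shiftbK/= subrr.
move=> ig2; rewrite shiftbK/= subrr (Rintegral_itv_obnd_cbnd if2') => e2.
have e1g : {in `[0, a]%classic, f1 =1 glueat a f1 f2}.
  by move=> x; rewrite inE/= in_itv/= /glueat => /andP[_ ->].
have e2g : {in [set` Interval (BRight a) (shiftb a B)],
    (fun x => f2 (x - a)) =1 glueat a f1 f2}.
  move=> x; rewrite inE/= itv_boundlr => /andP[+ _].
  by rewrite bnd_simp /glueat => ax; rewrite leNgt ax.
have ig1 : mu.-integrable `[0, a] (EFin \o glueat a f1 f2).
  by apply: eq_integrable if1 => // x xa /=; rewrite e1g.
have {}ig2 : mu.-integrable [set` Interval (BRight a) (shiftb a B)]
    (EFin \o glueat a f1 f2).
  by apply: eq_integrable ig2 => // x xa /=; rewrite e2g.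
have DE : [set` Interval (BLeft 0) (shiftb a B)] =
   `[0, a] `|` [set` Interval (BRight a) (shiftb a B)].
  by apply: itv_bndbnd_setU => //; rewrite bnd_simp.
have disj : [disjoint `[0, a]%classic & [set` Interval (BRight a) (shiftb a B)]].
  apply/disj_setPS => x [/=]; rewrite in_itv/= => /andP[_ xa].
  by rewrite itv_boundlr => /andP[]; rewrite bnd_simp ltNge xa.
have itU : mu.-integrable [set` Interval (BLeft 0) (shiftb a B)]
    (EFin \o glueat a f1 f2).
  by rewrite DE; apply: integrable_setU.
split => //.
rewrite DE Rintegral_setU//=; last by rewrite -DE.
by rewrite -e2 -(eq_Rintegral mu e1g) -(eq_Rintegral mu e2g).
Qed.

End IntervalIntegrals.

(** * Functions with a square-integrable weak derivative *)

Section SobolevOneDim.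
Variable R : realType.
Notation mu := (@lebesgue_measure R).
Implicit Types (D : set R) (u g : R -> R).

(** For a fixed weight [l], this form of Cauchy-Schwarz is linear in the two squares, hence adds up
    over intervals and over edges. The weight is optimised only at the end. *)
Lemma amgm_scaled (l a b : R) : 0 < l -> 2 * a * b <= l * a ^+ 2 + l^-1 * b ^+ 2.
Proof.
move=> l0; rewrite -subr_ge0.
have -> : l * a ^+ 2 + l^-1 * b ^+ 2 - 2 * a * b = l^-1 * (l * a - b) ^+ 2.
  by field; rewrite gt_eqF.
by rewrite mulr_ge0 ?sqr_ge0// invr_ge0 ltW.
Qed.

(** Asking the identity on every subsegment of [D], and not only from a base point, suits
    restriction, translation and gluing. Continuity of [u] on segments is a consequence. *)
Definition H1on D u g := [/\ measurable_fun D g,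
  mu.-integrable D (EFin \o (fun x => g x ^+ 2)) &
  forall x y, x <= y -> `[x, y] `<=` D ->
    u y - u x = \int[mu]_(t in `[x, y]) g t].

(** The optimal weight is [l = a / A], which balances [l * A] against [a]. *)
Lemma le_sqrM_of_amgm (a A B : R) : 0 <= a -> 0 <= A -> 0 <= B ->
  (forall l, 0 < l -> 2 * a <= l * A + l^-1 * B) -> a ^+ 2 <= A * B.
Proof.
move=> a0 A0 B0 H.
have [->|an0] := eqVneq a 0; first by rewrite expr0n/= mulr_ge0.
have {}a0 : 0 < a by rewrite lt_neqAle eq_sym an0.
have [AE|An0] := eqVneq A 0.
  (* When [A = 0] a large weight gives the contradiction: this one makes [l^-1 * B] smaller than
     [a]. *)
  have l0 : 0 < (B + 1) / a by rewrite divr_gt0//; lra.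
  have := H _ l0; rewrite AE mulr0 add0r invf_div => H1.
  have H2 : 2 * a * (B + 1) <= a * B.
    by move: H1; rewrite mulrAC ler_pdivlMr//; lra.
  exfalso; nra.
have {}A0 : 0 < A by rewrite lt_neqAle eq_sym An0.
have := H _ (divr_gt0 a0 A0).
rewrite divfK// invf_div => H1.
have {}H1 : a <= A / a * B by lra.
by move: H1; rewrite mulrAC ler_pdivlMr// expr2.
Qed.

Section OneFunction.
Variables (D : set R) (u g : R -> R).
Hypothesis mD : measurable D.
Hypothesis H : H1on D u g.

Lemma H1on_integrable_deriv x y : `[x, y] `<=` D ->
  mu.-integrable `[x, y] (EFin \o g).
Proof.
move=> xyD; have [mg ig ug] := H.
apply: integrable_itv_of_sqr; first exact: measurable_funS mg.
exact: integrableS ig.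
Qed.

Lemma H1on_osc_norm x y : x <= y -> `[x, y] `<=` D ->
  `|u y - u x| <= \int[mu]_(t in `[x, y]) `|g t|.
Proof.
move=> xy xyD; have [mg ig ug] := H; rewrite ug//.
by apply: le_normr_Rintegral => //; exact: H1on_integrable_deriv.
Qed.

Lemma H1on_osc_amgm (l x y : R) : 0 < l -> x <= y -> `[x, y] `<=` D ->
  2 * `|u y - u x| <= l * (y - x) + l^-1 * \int[mu]_(t in `[x, y]) g t ^+ 2.
Proof.
move=> l0 xy xyD; have [mg ig ug] := H.
have ig' : mu.-integrable `[x, y] (EFin \o (fun t => g t ^+ 2)).
  exact: integrableS ig.
have igz : mu.-integrable `[x, y] (EFin \o (fun t => l^-1 * g t ^+ 2)).
  exact: (integrableZl _ l^-1 ig').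
rewrite -Rintegral_itv_cst// -RintegralZl// -RintegralD//; last first.
  exact: integrable_itv_cst.
apply: le_trans (_ : 2 * \int[mu]_(t in `[x, y]) `|g t| <= _).
  by rewrite ler_wpM2l// H1on_osc_norm.
have ign : mu.-integrable `[x, y] (EFin \o (fun t => `|g t|)).
  exact: (integrable_norm (H1on_integrable_deriv xyD)).
rewrite -RintegralZl//; apply: le_Rintegral => //.
- exact: (integrableZl _ 2 ign).
- by apply: (integrableD _ (integrable_itv_cst x y l) igz).
- move=> t _; rewrite -[g t ^+ 2]ger0_norm ?sqr_ge0// normrX.
  by have := amgm_scaled 1 `|g t| l0; rewrite expr1n !mulr1.
Qed.

Lemma H1on_osc x y : x <= y -> `[x, y] `<=` D ->
  (u y - u x) ^+ 2 <= (y - x) * \int[mu]_(t in `[x, y]) g t ^+ 2.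
Proof.
move=> xy xyD; rewrite -[leLHS]ger0_norm ?sqr_ge0// normrX.
apply: le_sqrM_of_amgm => //; first by rewrite subr_ge0.
  by apply: Rintegral_ge0 => t _; exact: sqr_ge0.
by move=> l l0; exact: H1on_osc_amgm.
Qed.

Lemma H1on_itv_continuous x y : x <= y -> `[x, y] `<=` D ->
  {within `[x, y], continuous u}.
Proof.
move=> xy xyD; have [mg ig ug] := H.
apply: (@subspace_eq_continuous _ _ _
  ((fun z => u x + parameterized_integral mu x z g) : subspace `[x, y] -> R)).
  move=> z; rewrite inE /= in_itv/= => /andP[xz zy].
  rewrite /parameterized_integral -ug//; first by rewrite addrC subrK.
  by apply: subset_trans xyD; apply: subset_itvl; rewrite bnd_simp.
move=> z; apply: cvgD; first exact: cvg_cst.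
exact: parameterized_integral_continuous (H1on_integrable_deriv xyD) z.
Qed.

Lemma H1on_itv_measurable x y : x <= y -> `[x, y] `<=` D ->
  measurable_fun `[x, y] u.
Proof.
move=> xy xyD; apply: subspace_continuous_measurable_fun => //.
exact: H1on_itv_continuous.
Qed.

End OneFunction.
End SobolevOneDim.

(** * Variation of the square of a function, and pointwise bounds on the half-line *)

Section SquareVariation.
Variable R : realType.
Notation mu := (@lebesgue_measure R).
Implicit Types (D : set R) (u g : R -> R).

Section OneFunction.
Variables (D : set R) (u g : R -> R).
Hypothesis mD : measurable D.
Hypothesis H : H1on D u g.

Lemma H1on_itv_integrable_sqr x y : x <= y -> `[x, y] `<=` D ->
  mu.-integrable `[x, y] (EFin \o (fun t => u t ^+ 2)).
Proof.
move=> xy xyD; apply: continuous_compact_integrable; first exact: segment_compact.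
have cu := H1on_itv_continuous mD H xy xyD.
rewrite (_ : (fun t => u t ^+ 2) = (fun t => u t * u t)); last first.
  by apply/funext => t; rewrite expr2.
by move=> z; apply: cvgM; exact: cu.
Qed.

(* This replaces the product rule for [u ^+ 2].  If [u] oscillates by at most
   [w] on [[x, y]], then [|u y + u x| <= 2 |u t| + 2 w] for every [t] in it and
   the bound (with an error term linear in [w]) follows by integrating
   [|g t| |u y + u x|]; by [H1on_osc] this covers [n = 0].  Bisecting the
   interval halves [y - x] while the right-hand sides add up. *)
Lemma H1on_sqr_var_approx (X Y l w : R) n x y : `[X, Y] `<=` D -> 0 < l ->
  0 <= w -> X <= x -> x <= y -> y <= Y ->
  (y - x) * \int[mu]_(t in `[X, Y]) g t ^+ 2 <= 2 ^+ n * w ^+ 2 ->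
  `|u y ^+ 2 - u x ^+ 2| <= l * \int[mu]_(t in `[x, y]) u t ^+ 2
    + l^-1 * \int[mu]_(t in `[x, y]) g t ^+ 2
    + w * ((y - x) + \int[mu]_(t in `[x, y]) g t ^+ 2).
Proof.
move=> XYD l0 w0; have [mg ig ug] := H.
elim: n x y => [|n IHn] x y Xx xy yY.
  have sub a b : x <= a -> b <= y -> `[a, b] `<=` `[X, Y].
    by move=> xa by' t /=; rewrite !in_itv/= => /andP[at' tb]; apply/andP; split; lra.
  have xyD : `[x, y] `<=` D by apply: subset_trans (sub _ _ _ _) XYD.
  rewrite expr0 mul1r => hw.
  have igs : mu.-integrable `[X, Y] (EFin \o (fun t => g t ^+ 2)).
    exact: integrableS ig.
  have igs' : mu.-integrable `[x, y] (EFin \o (fun t => g t ^+ 2)).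
    exact: integrableS ig.
  have ius : mu.-integrable `[x, y] (EFin \o (fun t => u t ^+ 2)).
    exact: H1on_itv_integrable_sqr.
  have ign : mu.-integrable `[x, y] (EFin \o (fun t => `|g t|)).
    exact: (integrable_norm (H1on_integrable_deriv mD H xyD)).
  have osc s t : x <= s -> s <= t -> t <= y -> `|u t - u s| <= w.
    move=> xs st ty; rewrite -(@ler_pXn2r _ 2)// ?nnegrE// -normrX ger0_norm ?sqr_ge0//.
    have stXY : `[s, t] `<=` `[X, Y] by apply: sub; lra.
    have stD : `[s, t] `<=` D by exact: subset_trans XYD.
    apply: le_trans (H1on_osc mD H st stD) _; apply: le_trans hw.
    apply: ler_pM; [lra| by apply: Rintegral_ge0 => r _; exact: sqr_ge0|lra|].
    apply: le_Rintegral_set => //.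
    by move=> r _; exact: sqr_ge0.
  rewrite subr_sqr normrM.
  apply: le_trans (_ : (\int[mu]_(t in `[x, y]) `|g t|) * `|u y + u x| <= _).
    by rewrite ler_wpM2r// (H1on_osc_norm mD H).
  rewrite mulrC -[leLHS]RintegralZl//.
  have i1 : mu.-integrable `[x, y] (EFin \o (fun t => l * u t ^+ 2)).
    exact: (integrableZl _ l ius).
  have i2 : mu.-integrable `[x, y] (EFin \o (fun t => l^-1 * g t ^+ 2)).
    exact: (integrableZl _ l^-1 igs').
  have i3 : mu.-integrable `[x, y] (EFin \o (fun t => w * g t ^+ 2)).
    exact: (integrableZl _ w igs').
  have i4 : mu.-integrable `[x, y] (EFin \o (fun t => w + w * g t ^+ 2)).
    exact: (integrableD _ (integrable_itv_cst x y w) i3).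
  have i5 : mu.-integrable `[x, y] (EFin \o (fun t => l * u t ^+ 2 + l^-1 * g t ^+ 2)).
    exact: (integrableD _ i1 i2).
  have -> : l * \int[mu]_(t in `[x, y]) u t ^+ 2
    + l^-1 * \int[mu]_(t in `[x, y]) g t ^+ 2
    + w * ((y - x) + \int[mu]_(t in `[x, y]) g t ^+ 2) =
    \int[mu]_(t in `[x, y]) (l * u t ^+ 2 + l^-1 * g t ^+ 2 + (w + w * g t ^+ 2)).
    rewrite (RintegralD _ i5 i4)// (RintegralD _ i1 i2)//.
    rewrite (RintegralD _ (integrable_itv_cst x y w) i3)//.
    by rewrite !RintegralZl// Rintegral_itv_cst// mulrDr.
  apply: le_Rintegral => //.
  - exact: (integrableZl _ `|u y + u x| ign).
  - exact: (integrableD _ i5 i4).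
  move=> t; rewrite /= in_itv/= => /andP[xt ty].
  have c1 : `|u y + u x| <= 2 * `|u t| + 2 * w.
    have := osc t y xt ty (lexx _); have := osc x t (lexx _) xt ty.
    rewrite !ler_norml => /andP[? ?] /andP[? ?].
    have := ler_norm (u t); have := ler_norm (- u t); rewrite normrN => ? ?.
    by apply/andP; split; lra.
  have := amgm_scaled `|u t| `|g t| l0.
  rewrite -!normrX ![`|_ ^+ 2|]ger0_norm ?sqr_ge0// => h1.
  have h2 : 2 * `|g t| <= 1 + g t ^+ 2.
    have := @amgm_scaled R 1 1 `|g t| ltr01.
    by rewrite -!normrX ![`|_ ^+ 2|]ger0_norm ?sqr_ge0// invr1; lra.
  have h3 := ler_wpM2r (normr_ge0 (g t)) c1.
  have h4 := ler_wpM2l w0 h2.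
  by move: h3 h4; rewrite !(mulrDl, mulrDr); lra.
rewrite exprS => hw; pose m := (x + y) / 2.
have xm : x <= m by rewrite /m; lra.
have my : m <= y by rewrite /m; lra.
have xyD : `[x, y] `<=` D.
  apply: subset_trans XYD => t /=; rewrite !in_itv/= => /andP[? ?].
  by apply/andP; split; lra.
have h1 := IHn x m Xx xm (le_trans my yY).
have h2 := IHn m y (le_trans Xx xm) my yY.
rewrite !(@Rintegral_split _ x m (BRight y)) ?bnd_simp//; last 2 first.
- exact: integrableS ig.
- exact: H1on_itv_integrable_sqr.
have hm : (m - x) * \int[mu]_(t in `[X, Y]) g t ^+ 2 <= 2 ^+ n * w ^+ 2.
  by move: hw; rewrite /m; lra.
have hm' : (y - m) * \int[mu]_(t in `[X, Y]) g t ^+ 2 <= 2 ^+ n * w ^+ 2.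
  by move: hw; rewrite /m; lra.
move: (h1 hm) (h2 hm').
have -> : y - x = (m - x) + (y - m) by ring.
move: (\int[mu]_(t in `[x, m]) u t ^+ 2) (\int[mu]_(t in `[m, y]) u t ^+ 2)
  (\int[mu]_(t in `[x, m]) g t ^+ 2) (\int[mu]_(t in `[m, y]) g t ^+ 2)
  (u x ^+ 2) (u y ^+ 2) (u m ^+ 2) (m - x) (y - m) l^-1 => a1 a2 b1 b2 c1 c2 c3 d1 d2 li.
rewrite !ler_norml => /andP[e1 e2] /andP[e3 e4].
by clear -e1 e2 e3 e4; apply/andP; split; lra.
Qed.

Lemma H1on_sqr_var (l x y : R) : 0 < l -> x <= y -> `[x, y] `<=` D ->
  `|u y ^+ 2 - u x ^+ 2| <= l * \int[mu]_(t in `[x, y]) u t ^+ 2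
    + l^-1 * \int[mu]_(t in `[x, y]) g t ^+ 2.
Proof.
move=> l0 xy xyD; apply/ler_addgt0Pr => e e0.
set K := \int[mu]_(t in `[x, y]) g t ^+ 2.
have K0 : 0 <= K by apply: Rintegral_ge0 => t _; exact: sqr_ge0.
(* This [w] keeps the error term below [e]; a large enough number [n] of bisections then meets the
   smallness condition for this same [w]. *)
pose w := e / (y - x + K + 1).
have d0 : 0 < y - x + K + 1 by lra.
have w0 : 0 < w by rewrite divr_gt0.
have [n hn] : exists n, (y - x) * K <= 2 ^+ n * w ^+ 2.
  exists (Num.Def.archi_bound ((y - x) * K / w ^+ 2)).
  rewrite -ler_pdivrMr ?exprn_gt0//; apply/ltW.
  exact: upper_nthrootP.
apply: le_trans (H1on_sqr_var_approx xyD l0 (ltW w0) (lexx x) xy (lexx y) hn) _.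
rewrite lerD2l /w mulrAC ler_pdivrMr// ler_pM2l// -/K; lra.
Qed.

End OneFunction.

Section HalfLine.
Variables (u g : R -> R).
Hypothesis H : H1on `[0, +oo[ u g.

Lemma H1on_halfline_measurable : measurable_fun (`[0, +oo[ : set R) u.
Proof.
rewrite itv_bndy_bigcup_BRight; apply/measurable_fun_bigcup => // n.
have n0 : (0 : R) <= 0 + n%:R by rewrite add0r.
by apply: (H1on_itv_measurable _ H n0) => // t /=; rewrite !in_itv/= andbT => /andP[].
Qed.

Hypothesis iu : mu.-integrable `[0, +oo[ (EFin \o (fun t => u t ^+ 2)).

(** Otherwise [u ^+ 2] would exceed [e] on a segment of length [(M + 1) / e], and its integral would
    exceed the total [M]. *)
Lemma H1on_halfline_small (x e : R) : 0 <= x -> 0 < e ->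
  exists2 y, x <= y & u y ^+ 2 <= e.
Proof.
move=> x0 e0; apply: contrapT => /forall2NP nex.
set M := \int[mu]_(t in `[0, +oo[) u t ^+ 2.
have M0 : 0 <= M by apply: Rintegral_ge0 => t _; exact: sqr_ge0.
pose y := x + (M + 1) / e.
have xy : x <= y by rewrite lerDl divr_ge0//; lra.
have sub : `[x, y] `<=` `[0, +oo[.
  by move=> t /=; rewrite !in_itv/= andbT => /andP[xt _]; lra.
have : e * (y - x) <= M.
  rewrite -Rintegral_itv_cst//.
  apply: le_trans (_ : \int[mu]_(t in `[x, y]) u t ^+ 2 <= _).
    apply: le_Rintegral => //; first exact: integrable_itv_cst.
      exact: integrableS iu.
    move=> t /=; rewrite in_itv/= => /andP[xt _].
    by have [//|/negP] := nex t; rewrite -ltNge => /ltW.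
  by apply: le_Rintegral_set => // t _; exact: sqr_ge0.
by rewrite /y addrAC subrr add0r mulrC divfK ?gt_eqF//; lra.
Qed.

(** The variation of [u ^+ 2] is bounded between [x] and a far point where [u] is almost zero.
    Optimising [l] would give the Gagliardo-Nirenberg inequality for the sup norm. *)
Lemma H1on_halfline_sqr (l x : R) : 0 < l -> 0 <= x ->
  u x ^+ 2 <= l * \int[mu]_(t in `[x, +oo[) u t ^+ 2
    + l^-1 * \int[mu]_(t in `[x, +oo[) g t ^+ 2.
Proof.
move=> l0 x0; apply/ler_addgt0Pr => e e0.
have [mg ig ug] := H.
have [y xy uy] := H1on_halfline_small x0 e0.
have sub0 : `[x, +oo[ `<=` `[0, +oo[.
  by move=> t /=; rewrite !in_itv/= !andbT => xt; lra.
have sub1 : `[x, y] `<=` `[x, +oo[.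
  by move=> t /=; rewrite !in_itv/= andbT => /andP[].
have := H1on_sqr_var _ H l0 xy (subset_trans sub1 sub0).
move=> /(_ (measurable_itv _)); rewrite ler_norml => /andP[h _].
have h1 : l * \int[mu]_(t in `[x, y]) u t ^+ 2 <= l * \int[mu]_(t in `[x, +oo[) u t ^+ 2.
  rewrite ler_pM2l//; apply: le_Rintegral_set => //; last exact: integrableS iu.
  by move=> t _; exact: sqr_ge0.
have h2 : l^-1 * \int[mu]_(t in `[x, y]) g t ^+ 2 <= l^-1 * \int[mu]_(t in `[x, +oo[) g t ^+ 2.
  rewrite ler_pM2l ?invr_gt0//; apply: le_Rintegral_set => //; last exact: integrableS ig.
  by move=> t _; exact: sqr_ge0.
lra.
Qed.

End HalfLine.
End SquareVariation.


(** * Scaling, translation and gluing of functions with a weak derivative *)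

Section Constructions.
Variable R : realType.
Notation mu := (@lebesgue_measure R).
Implicit Types (D : set R) (u g : R -> R).

Lemma H1on_scale D u g (s : R) : measurable D -> H1on D u g ->
  H1on D (fun x => s * u x) (fun x => s * g x).
Proof.
move=> mD H; have [mg ig ug] := H; split.
- by apply: measurable_funM => //; exact: measurable_cst.
- rewrite (_ : (fun x => (s * g x) ^+ 2) = (fun x => s ^+ 2 * g x ^+ 2)).
    exact: (integrableZl _ (s ^+ 2) ig).
  by apply/funext => x; rewrite exprMn.
- move=> x y xy xyD; rewrite -mulrBr ug// RintegralZl//.
  exact: (H1on_integrable_deriv mD H).
Qed.

Lemma H1on_halflineP u g : measurable_fun (`[0, +oo[ : set R) g ->
  mu.-integrable `[0, +oo[ (EFin \o (fun t => g t ^+ 2)) ->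
  (forall x, 0 <= x -> mu.-integrable `[0, x] (EFin \o g)) ->
  (forall x, 0 <= x -> u x = u 0 + \int[mu]_(t in `[0, x]) g t) ->
  H1on `[0, +oo[ u g.
Proof.
move=> mg ig il ug; split => // x y xy xyD.
have x0 : 0 <= x.
  by have := xyD x; rewrite /= !in_itv/= lexx xy/= andbT; apply.
have y0 := le_trans x0 xy.
rewrite (ug y)// (ug x)// (@Rintegral_split _ 0 x (BRight y)) ?bnd_simp//.
  by ring.
exact: il.
Qed.

Lemma H1on_shift u g (c : R) : 0 <= c -> H1on `[0, +oo[ u g ->
  H1on `[0, +oo[ (fun x => u (x + c)) (fun x => g (x + c)).
Proof.
move=> c0 H; have [mg ig ug] := H.
have sub : `[0 + c, +oo[ `<=` `[0, +oo[.
  by move=> t /=; rewrite !in_itv/= !andbT; lra.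
split.
- apply: (measurable_fun_shift _ _ _ mg) => //.
  by move=> t; rewrite /= !in_itv/= !andbT; lra.
- have [] := @Rintegral_shift R c (BLeft 0) (BInfty R false) (fun t => g t ^+ 2) => //.
  exact: integrableS ig.
- move=> x y xy xyD.
  have x0 : 0 <= x.
    by have := xyD x; rewrite /= !in_itv/= lexx xy/= andbT; apply.
  have sub2 : `[x + c, y + c] `<=` `[0, +oo[.
    by move=> t /=; rewrite !in_itv/= andbT => /andP[]; lra.
  rewrite ug ?lerD2r//.
  have [|_ ->//] := @Rintegral_shift R c (BLeft x) (BRight y) g.
  exact: (H1on_integrable_deriv _ H).
Qed.

Lemma H1on_affine (A k a : R) : H1on `[0, a] (fun x => A + k * x) (fun=> k).
Proof.
split.
- exact: measurable_cst.
- exact: integrable_itv_cst.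
- by move=> x y xy _; rewrite Rintegral_itv_cst//; ring.
Qed.

Lemma H1on_glue (a : R) u1 g1 u2 g2 : 0 <= a -> u1 a = u2 0 ->
  H1on `[0, a] u1 g1 -> H1on `[0, +oo[ u2 g2 ->
  H1on `[0, +oo[ (glueat a u1 u2) (glueat a g1 g2).
Proof.
move=> a0 e12 H1 H2; have [mg1 ig1 ug1] := H1; have [mg2 ig2 ug2] := H2.
have sqE : (fun t => glueat a g1 g2 t ^+ 2) =
    glueat a (fun t => g1 t ^+ 2) (fun t => g2 t ^+ 2).
  by apply/funext => t; rewrite /glueat; case: ifP.
have DE : `[0, +oo[%classic = `[0, a]%classic `|` `]a, +oo[%classic.
  by apply: itv_bndbnd_setU => //; rewrite bnd_simp.
have gl x : 0 <= x -> x <= a -> mu.-integrable `[0, x] (EFin \o glueat a g1 g2) /\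
   \int[mu]_(t in `[0, x]) glueat a g1 g2 t = \int[mu]_(t in `[0, x]) g1 t.
  move=> x0 xa.
  have e : {in `[0, x]%classic, g1 =1 glueat a g1 g2}.
    move=> t; rewrite inE/= in_itv/= /glueat => /andP[_ tx].
    by rewrite (le_trans tx xa).
  split; last by apply/esym/eq_Rintegral.
  have ig1x : mu.-integrable `[0, x] (EFin \o g1).
    apply: (H1on_integrable_deriv _ H1) => //.
    by apply: subset_itvl; rewrite bnd_simp.
  by apply: eq_integrable ig1x => // t tx /=; rewrite e.
have gr x : a <= x -> mu.-integrable `[0, x] (EFin \o glueat a g1 g2) /\
   \int[mu]_(t in `[0, x]) glueat a g1 g2 t =
   \int[mu]_(t in `[0, a]) g1 t + \int[mu]_(t in `[0, x - a]) g2 t.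
  move=> ax; have := @Rintegral_glue R a (BRight (x - a)) g1 g2 a0.
  rewrite /= subrK; apply.
  - by rewrite bnd_simp subr_ge0.
  - exact: (H1on_integrable_deriv _ H1).
  - apply: (H1on_integrable_deriv _ H2) => // t /=.
    by rewrite !in_itv/= andbT => /andP[].
apply: H1on_halflineP.
- rewrite DE; apply/measurable_funU => //; split.
    apply: eq_measurable_fun mg1 => t; rewrite inE/= in_itv/= /glueat => /andP[_ ->//].
  have mg2' : measurable_fun `]a, +oo[ (fun t => g2 (t - a)).
    apply: (measurable_fun_shift _ _ _ mg2) => //.
    by move=> t; rewrite /= !in_itv/= !andbT; lra.
  apply: eq_measurable_fun mg2' => t.
  by rewrite inE/= in_itv/= /glueat andbT leNgt => ->.
- rewrite sqE; have [] // := @Rintegral_glue R a (BInfty R false)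
    (fun t => g1 t ^+ 2) (fun t => g2 t ^+ 2) a0.
- move=> x x0; have [xa|/ltW ax] := leP x a.
    by have [] := gl x x0 xa.
  by have [] := gr x ax.
- move=> x x0; have [xa|ax] := leP x a.
    have [_ ->] := gl x x0 xa.
    rewrite /glueat xa a0 -ug1//; first by ring.
    by apply: subset_itvl; rewrite bnd_simp.
  have [_ ->] := gr x (ltW ax).
  rewrite /glueat leNgt ax/= a0 -ug1// -ug2; first by rewrite e12; ring.
  + by rewrite subr_ge0 ltW.
  + by move=> t /=; rewrite !in_itv/= andbT => /andP[].
Qed.

End Constructions.

(** * Paths and distances in the compact core *)

Section CoreGeometry.
Variables (R : realType) (G : mgraph R).
Hypothesis G_valid : valid_graph G.

Let elen_ge0 e : 0 <= elen G e. Proof. by rewrite ltW// G_valid.1. Qed.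

Lemma walk_length_ge0 s : 0 <= walk_length (G := G) s.
Proof. by apply: sumr_ge0. Qed.

(** Here [y] is the end at which the walk leaves [e]; an edge may be crossed in either direction,
    hence the disjunction. *)
Lemma walk_suffix a t b e : walk (G := G) a t b -> e \in t ->
  exists y t1 t2, [/\ t = t1 ++ e :: t2, walk y t2 b &
    y = edst G e \/ y = esrc G e].
Proof.
elim: t a => // f t IHt a /=; rewrite inE.
have [<-|ef /=] := eqVneq e f.
  move=> /orP[]/andP[_ wt] _.
  - by exists (edst G e), [::], t; split => //; left.
  - by exists (esrc G e), [::], t; split => //; right.
move=> wt et.
have [c wct] : exists c, walk c t b by case/orP: wt => /andP[_ ?]; eexists; eassumption.
have [y [t1 [t2 [-> wy ye]]]] := IHt c wct et.
by exists y, (f :: t1), t2.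
Qed.

(* A repeated edge can be short-cut, whichever way it is traversed twice. *)
Lemma walk_uniq a s b : walk (G := G) a s b ->
  exists t, [/\ walk a t b, uniq t & walk_length t <= walk_length s].
Proof.
elim: s a => [|e s IHs] a /=; first by move=> ab; exists [::].
move=> wes.
have [c [t [ae wt ut ts]]] : exists c t,
    [/\ (a = esrc G e /\ c = edst G e) \/ (a = edst G e /\ c = esrc G e),
        walk c t b, uniq t & walk_length t <= walk_length s].
  case/orP: wes => /andP[/eqP <- ws]; have [t [wt ut ts]] := IHs _ ws.
  - by exists (edst G e), t; split => //; left.
  - by exists (esrc G e), t; split => //; right.
rewrite /walk_length big_cons -/(walk_length s).
have [et|et] := boolP (e \in t); last first.
  exists (e :: t); split.
  - by case: ae => -[-> cE] /=; rewrite -cE wt eqxx ?orbT.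
  - by rewrite /= et.
  - by rewrite big_cons lerD2l.
have [y [t1 [t2 [tE wy ye]]]] := walk_suffix wt et.
have uet2 : uniq (e :: t2) by move: ut; rewrite tE cat_uniq => /and3P[].
have lent : walk_length (e :: t2) <= walk_length t.
  by rewrite tE /walk_length big_cat/= lerDr walk_length_ge0.
have lent2 : walk_length t2 <= walk_length (e :: t2).
  by rewrite /walk_length big_cons lerDr.
have e0 := elen_ge0 e.
(* If the later passage through [e] ends back at [a], both passages are dropped. Otherwise it ends
   at the far end of [e], and a single passage replaces everything up to it. *)
have [ya|ya] := eqVneq y a.
  exists t2; split; first by rewrite -ya.
  - by move: uet2 => /= /andP[].
  - by rewrite (le_trans lent2)// (le_trans lent)// (le_trans ts)// lerDr.
exists (e :: t2); split => //; last first.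
  by rewrite (le_trans lent)// (le_trans ts)// lerDr.
move: ya; rewrite /=; case: ae => -[-> _]; case: ye => yE; rewrite -?yE ?eqxx ?wy ?orbT//.
Qed.

Lemma big_uniq_le (T : finType) (t : seq T) (w : T -> R) : uniq t ->
  (forall e, 0 <= w e) -> \sum_(e <- t) w e <= \sum_e w e.
Proof.
move=> ut w0; rewrite big_uniq// [leRHS](bigID (fun e => e \in t))/= lerDl.
exact: sumr_ge0.
Qed.

Lemma walk_var (F : 'I_(nv G) -> R) (w : 'I_(ne G) -> R) a s b :
  (forall e, `|F (edst G e) - F (esrc G e)| <= w e) -> walk a s b ->
  `|F b - F a| <= \sum_(e <- s) w e.
Proof.
move=> Fw; elim: s a => [|e s IHs] a /=.
  by move=> /eqP ->; rewrite big_nil subrr normr0.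
rewrite big_cons => /orP[]/andP[/eqP <- ws]; have h := IHs _ ws.
- have -> : F b - F (esrc G e) = (F (edst G e) - F (esrc G e)) + (F b - F (edst G e)).
    by ring.
  exact: le_trans (ler_normD _ _) (lerD (Fw e) h).
- have -> : F b - F (edst G e) = (F (esrc G e) - F (edst G e)) + (F b - F (esrc G e)).
    by ring.
  apply: le_trans (ler_normD _ _) (lerD _ h).
  by rewrite distrC.
Qed.

(** A walk without repeated edges charges each edge at most once, so the bound does not depend on
    the walk. *)
Lemma connected_var (F : 'I_(nv G) -> R) (w : 'I_(ne G) -> R) a b :
  (forall e, `|F (edst G e) - F (esrc G e)| <= w e) ->
  `|F b - F a| <= \sum_e w e.
Proof.
move=> Fw; have [s ws] := G_valid.2 a b.
have [t [wt ut _]] := walk_uniq ws.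
apply: le_trans (walk_var Fw wt) (big_uniq_le ut _) => e.
exact: le_trans (Fw e).
Qed.

Lemma core_length_ge0 : 0 <= core_length G.
Proof. by apply: sumr_ge0. Qed.

Lemma elen_le_core_length e : elen G e <= core_length G.
Proof. by rewrite /core_length (bigD1 e)//= lerDl sumr_ge0. Qed.

Lemma vdist_ge0 a b : 0 <= vdist (G := G) a b.
Proof.
have [s ws] := G_valid.2 a b; apply: lb_le_inf.
  by exists (walk_length s), s.
by move=> _ [t _ <-]; exact: walk_length_ge0.
Qed.

(** This makes the set of distances bounded, so that the supremum defining the diameter is not a
    default value. *)
Lemma vdist_le_core_length a b : vdist (G := G) a b <= core_length G.
Proof.
have [s ws] := G_valid.2 a b; have [t [wt ut _]] := walk_uniq ws.
apply: (@le_trans _ _ (walk_length t)); last exact: big_uniq_le.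
apply: ge_inf; last by exists t.
by exists 0 => _ [r _ <-]; exact: walk_length_ge0.
Qed.

(** Cauchy-Schwarz along a walk stripped of repeated edges: stripping does not increase its length,
    and its edges carry at most the total of [k]. The infimum over walks comes last. *)
Lemma vdist_osc (F : 'I_(nv G) -> R) (k : 'I_(ne G) -> R) a b :
  (forall e, 0 <= k e) ->
  (forall l, 0 < l -> forall e,
    2 * `|F (edst G e) - F (esrc G e)| <= l * elen G e + l^-1 * k e) ->
  (F b - F a) ^+ 2 <= vdist a b * \sum_e k e.
Proof.
move=> k0 Fk; set K := \sum_e k e.
have K0 : 0 <= K by exact: sumr_ge0.
have walk_osc s : walk a s b -> (F b - F a) ^+ 2 <= walk_length s * K.
  move=> ws; have [t [wt ut ts]] := walk_uniq ws.
  rewrite -[leLHS]ger0_norm ?sqr_ge0// normrX.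
  apply: le_sqrM_of_amgm => //; first exact: walk_length_ge0.
  move=> l l0.
  have Fw e : `|F (edst G e) - F (esrc G e)| <= 2^-1 * (l * elen G e + l^-1 * k e).
    by rewrite ler_pdivlMl// Fk.
  have := walk_var Fw wt; rewrite -mulr_sumr big_split/= -!mulr_sumr.
  rewrite ler_pdivlMl// => /le_trans; apply; apply: lerD.
    by rewrite ler_pM2l.
  by rewrite ler_pM2l ?invr_gt0// big_uniq_le.
have [s ws] := G_valid.2 a b.
(* Passing to the infimum divides by [K]; when [K = 0] any single walk suffices. *)
have [KE|Kn0] := eqVneq K 0.
  by rewrite KE mulr0; have := walk_osc s ws; rewrite KE mulr0.
have {}K0 : 0 < K by rewrite lt_neqAle eq_sym Kn0.
rewrite -ler_pdivrMr//; apply: lb_le_inf; first by exists (walk_length s), s.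
by move=> _ [r wr <-]; rewrite ler_pdivrMr// walk_osc.
Qed.

(** A copy of the list [ends] local to [kdist]: the two exits from [z], each with its distance along
    the edge. *)
Definition kends (z : 'I_(ne G) * R) : seq ('I_(nv G) * R) :=
  [:: (esrc G z.1, z.2); (edst G z.1, elen G z.1 - z.2)].

Lemma big_min_mem (x0 : R) s : \big[Order.min/x0]_(c <- s) c \in x0 :: s.
Proof.
elim: s => [|c s IHs]; first by rewrite big_nil inE.
rewrite big_cons minEle; case: ifP => _; first by rewrite !inE eqxx orbT.
by move: IHs; rewrite !inE => /orP[->//|->]; rewrite !orbT.
Qed.

(** The default value of the minimum is the head of a nonempty list, hence itself a candidate: no
    spurious 0 can occur, and the distance is realised by one of the listed routes. *)
Lemma kdistP x y :
  (x.1 = y.1 /\ kdist (G := G) x y = `|x.2 - y.2|) \/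
  exists a b, [/\ a \in kends x, b \in kends y &
    kdist x y = a.2 + vdist a.1 b.1 + b.2].
Proof.
rewrite /kdist -/(kends x) -/(kends y).
set via := [seq _ | a <- kends x, b <- kends y].
have viaP c : c \in via -> exists a b, [/\ a \in kends x, b \in kends y &
    c = a.2 + vdist a.1 b.1 + b.2].
  by move=> /allpairsP[[a b] [ax bY ->]]; exists a, b.
case: eqP => [e|_].
  have := big_min_mem (head 0 (`|x.2 - y.2| :: via)) (`|x.2 - y.2| :: via).
  move: (\big[_/_]_(c <- _) c) => c0; rewrite inE => /orP[/eqP h|]; first by left.
  rewrite inE => /orP[/eqP h|h]; first by left.
  by right; exact: viaP.
right; apply: viaP.
have := big_min_mem (head 0 via) via.
move: (\big[_/_]_(c <- _) c) => c0; rewrite inE => /orP[/eqP -> |//].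
exact: mem_head.
Qed.

Lemma kends_bound z a : kpoint (G := G) z -> a \in kends z ->
  0 <= a.2 <= core_length G.
Proof.
move=> /andP[z0 zl]; have := elen_le_core_length z.1.
by rewrite !inE => h /orP[]/eqP -> /=; apply/andP; split; lra.
Qed.

Lemma kdist_le_core_diam x y : kpoint (G := G) x -> kpoint y ->
  kdist x y <= core_diam G.
Proof.
move=> kx ky; apply: ub_le_sup; last by exists x, y.
(* Two partial edges and one vertex distance, each at most the core length. *)
exists (3 * core_length G) => _ [x' [y' [kx' ky' ->]]].
have L0 := core_length_ge0.
have [[xy ->]|[a [b [ax bY ->]]]] := kdistP x' y'.
  move: kx' ky' => /andP[? ?] /andP[? ?].
  have := elen_le_core_length x'.1; have := elen_le_core_length y'.1 => ? ?.
  by rewrite ler_norml; apply/andP; split; lra.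
have /andP[_ ?] := kends_bound kx' ax; have /andP[_ ?] := kends_bound ky' bY.
have := vdist_le_core_length a.1 b.1; lra.
Qed.

(** A core of positive length has an edge, and connectedness then leaves no vertex isolated. This
    lets the value at the root of the half-line be read on an edge. *)
Lemma vertex_on_core v : 0 < core_length G -> exists e,
  esrc G e = v \/ edst G e = v.
Proof.
move=> L0.
have [e0] : exists e0 : 'I_(ne G), true.
  apply: contrapT => /forallNP H; move: L0; rewrite /core_length big1 ?ltxx// => e.
  by have := H e.
move=> _; have [[|e s]] := G_valid.2 v (esrc G e0).
  by move=> /eqP ->; exists e0; left.
by move=> /= /orP[]/andP[/eqP <- _]; exists e; [left|right].
Qed.

Section CoreFunction.
Variables (F : 'I_(nv G) -> R) (u : 'I_(ne G) -> R -> R) (k : 'I_(ne G) -> R).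
Hypothesis k0 : forall e, 0 <= k e.
Hypothesis uF : forall e, u e 0 = F (esrc G e) /\ u e (elen G e) = F (edst G e).
Hypothesis uk : forall l, 0 < l -> forall e s t, 0 <= s -> s <= t -> t <= elen G e ->
  2 * `|u e t - u e s| <= l * (t - s) + l^-1 * k e.

Let K := \sum_e k e.
Let K0 : 0 <= K. Proof. exact: sumr_ge0. Qed.
Let kK e : k e <= K.
Proof. by rewrite /K (bigD1 e)//= lerDl sumr_ge0. Qed.

Let u_osc e s t : 0 <= s -> s <= t -> t <= elen G e ->
  (u e t - u e s) ^+ 2 <= (t - s) * K.
Proof.
move=> s0 st tl; apply: (@le_trans _ _ ((t - s) * k e)); last first.
  by rewrite ler_wpM2l// subr_ge0.
rewrite -[leLHS]ger0_norm ?sqr_ge0// normrX.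
apply: le_sqrM_of_amgm => //; first by rewrite subr_ge0.
by move=> l l0; exact: uk.
Qed.

Let u_osc_end z a : kpoint (G := G) z -> a \in kends z ->
  (u z.1 z.2 - F a.1) ^+ 2 <= a.2 * K.
Proof.
move=> /andP[z0 zl]; rewrite !inE => /orP[]/eqP -> /=.
  by rewrite -(uF z.1).1 -[X in _ <= X * _]subr0; exact: u_osc.
by rewrite -(uF z.1).2 -[leLHS]sqrrN opprB; exact: u_osc.
Qed.

(** A shortest route has at most three legs: a partial edge, a walk and a partial edge. The squared
    increment over each is at most [core_diam G * K], and [(a + b + c)^2 <= 3 (a^2 + b^2 + c^2)]
    produces the 9. *)
Lemma core_osc x y : kpoint (G := G) x -> kpoint y ->
  (u x.1 x.2 - u y.1 y.2) ^+ 2 <= 9 * (core_diam G * K).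
Proof.
move=> kx ky; have := kdist_le_core_diam kx ky.
have D9 d : 0 <= d -> d <= core_diam G -> d * K <= core_diam G * K.
  by move=> _ dD; rewrite ler_wpM2r.
have [[xy ->]|[a [b [ax bY ->]]]] := kdistP x y.
  move=> dD; have h := D9 _ (normr_ge0 _) dD.
  suff : (u x.1 x.2 - u y.1 y.2) ^+ 2 <= `|x.2 - y.2| * K.
    have : 0 <= `|x.2 - y.2| * K by rewrite mulr_ge0.
    lra.
  move: kx ky => /andP[x0 xl] /andP[y0 yl]; rewrite -xy in yl *.
  have [xy2|/ltW xy2] := leP x.2 y.2.
    rewrite -sqrrN opprB distrC ger0_norm ?subr_ge0//; exact: u_osc.
  by rewrite ger0_norm ?subr_ge0//; apply: u_osc.
have /andP[a0 _] := kends_bound kx ax; have /andP[b0 _] := kends_bound ky bY.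
have v0 := vdist_ge0 a.1 b.1 => dD.
have h1 := u_osc_end kx ax; have h2 := u_osc_end ky bY.
have h3 : (F b.1 - F a.1) ^+ 2 <= vdist a.1 b.1 * K.
  apply: vdist_osc => // l l0 e; rewrite -(uF e).1 -(uF e).2.
  by rewrite -[X in _ <= l * X + _]subr0; exact: uk.
have dA := D9 _ a0 ltac:(lra); have dB := D9 _ b0 ltac:(lra).
have dV := D9 _ v0 ltac:(lra).
move: h1 h2 h3 dA dB dV.
set p := u x.1 x.2; set q := u y.1 y.2; set r := F a.1; set s := F b.1.
set DK := core_diam G * K.
move: (a.2 * K) (b.2 * K) (vdist a.1 b.1 * K) => A B V h1 h2 h3 dA dB dV.
clear -h1 h2 h3 dA dB dV.
have := sqr_ge0 ((p - r) - (r - s)); have := sqr_ge0 ((p - r) - (s - q)).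
have := sqr_ge0 ((r - s) - (s - q)); nra.
Qed.

End CoreFunction.
End CoreGeometry.

(** * Sup and power bounds on the graph *)

Section PowerBounds.
Variable R : realType.
Notation mu := (@lebesgue_measure R).

Lemma powR_norm_le (p S t : R) : 2 < p -> t ^+ 2 <= S ->
  `|t| `^ p <= S `^ ((p - 2) / 2) * t ^+ 2.
Proof.
move=> p2 tS.
have [->|t0] := eqVneq t 0.
  by rewrite normr0 powR0 ?expr0n/= ?mulr0// gt_eqF//; lra.
rewrite [X in `|t| `^ X](_ : p = (p - 2) + 2%:R); last by lra.
rewrite powRD; last by rewrite normr_eq0 t0 implybT.
have -> : `|t| `^ 2%:R = t ^+ 2.
  by rewrite powR_mulrn// -normrX ger0_norm// sqr_ge0.
rewrite ler_wpM2r ?sqr_ge0//.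
have -> : `|t| `^ (p - 2) = (t ^+ 2) `^ ((p - 2) / 2).
  rewrite -[t ^+ 2]ger0_norm ?sqr_ge0// normrX -powR_mulrn// -powRrM.
  by congr (_ `^ _); field.
by apply: ge0_ler_powR => //; rewrite ?nnegrE ?sqr_ge0 ?(le_trans (sqr_ge0 t) tS)//; lra.
Qed.

(* Bernoulli's inequality for [t^-1] and the exponent [- r]; it holds for [t < 1]
   as well as for [t > 1]. *)
Lemma powR_bernoulli (r t : R) : 0 < r -> 0 < t -> 1 - r * (t^-1 - 1) <= t `^ r.
Proof.
move=> r0 t0; rewrite /powR gt_eqF//.
apply: le_trans (expR_ge1Dx _); rewrite lerD2l -mulrN ler_pM2l//.
have ti0 : 0 < t^-1 by rewrite invr_gt0.
have := @le_ln1Dx R (t^-1 - 1); rewrite (_ : 1 + (t^-1 - 1) = t^-1); last by ring.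
rewrite lnV ?posrE//.
by move=> /(_ _); lra.
Qed.

Lemma integrable_powR_norm (D : set R) (f : R -> R) (p S : R) : 2 < p ->
  measurable D -> measurable_fun D f ->
  mu.-integrable D (EFin \o (fun t => f t ^+ 2)) ->
  (forall x, D x -> f x ^+ 2 <= S) ->
  mu.-integrable D (EFin \o (fun t => `|f t| `^ p)) /\
  \int[mu]_(t in D) `|f t| `^ p <=
    S `^ ((p - 2) / 2) * \int[mu]_(t in D) f t ^+ 2.
Proof.
move=> p2 mD mf if2 fS.
have ib : mu.-integrable D (EFin \o (fun t => S `^ ((p - 2) / 2) * f t ^+ 2)).
  exact: (integrableZl _ (S `^ ((p - 2) / 2)) if2).
have ip : mu.-integrable D (EFin \o (fun t => `|f t| `^ p)).
  apply: (@integrable_le R D _ (fun t => S `^ ((p - 2) / 2) * f t ^+ 2)) => //.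
  - apply: (@measurableT_comp _ _ _ _ _ _ (fun x : R => x `^ p)) => //.
    exact: measurableT_comp.
  - move=> x Dx; rewrite ger0_norm ?powR_ge0//.
    by apply: powR_norm_le => //; exact: fS.
split => //; rewrite -RintegralZl//; apply: le_Rintegral => //.
by move=> x Dx; apply: powR_norm_le => //; exact: fS.
Qed.

End PowerBounds.

Section GraphFunctions.
Variables (R : realType) (G : mgraph R).
Notation mu := (@lebesgue_measure R).
Hypothesis G_valid : valid_graph G.
Hypothesis core_gt0 : 0 < core_length G.

Lemma H1_intervalP l (u g : R -> R) : 0 <= l -> H1_interval l u g -> H1on `[0, l] u g.
Proof.
move=> l0 [mg [ig ug]]; rewrite /leb /seg in mg ig ug.
have ig2 := integrable_sqr (measurable_itv _) mg ig.
have il := integrable_itv_of_sqr mg ig2.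
split => // x y xy xyD.
have x0 : 0 <= x by have := xyD x; rewrite /= !in_itv/= lexx xy/= => /(_ isT) /andP[].
have yl : y <= l by have := xyD y; rewrite /= !in_itv/= lexx xy/= => /(_ isT) /andP[].
rewrite (ug y) ?(le_trans x0)// (ug x) ?x0 ?(le_trans xy)//.
rewrite (@Rintegral_split _ 0 x (BRight y)) ?bnd_simp//; first by ring.
by apply: integrableS il => //; apply: subset_itvl; rewrite bnd_simp.
Qed.

(** An equivalence, since competitors are built on the half-line as [H1on] functions and have to be
    converted back. *)
Lemma H1_halflineP (u g : R -> R) : H1_halfline u g <->
  H1on `[0, +oo[ u g /\ mu.-integrable `[0, +oo[ (EFin \o (fun t => u t ^+ 2)).
Proof.
split.
- move=> [mu_ [mg [iu [ig ug]]]]; rewrite /leb /seg /hl in mu_ mg iu ig ug.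
  have ig2 := integrable_sqr (measurable_itv _) mg ig.
  have iu2 := integrable_sqr (measurable_itv _) mu_ iu.
  split => //; apply: H1on_halflineP => // x x0.
  have sub : `[0, x] `<=` `[0, +oo[.
    by move=> t /=; rewrite !in_itv/= andbT => /andP[].
  apply: integrable_itv_of_sqr; first exact: measurable_funS mg.
  exact: integrableS ig2.
- move=> [H iu]; have [mg ig ug] := H; rewrite /H1_halfline /leb /seg /hl; split.
    exact: H1on_halfline_measurable H.
  have sqE (f : R -> R) : mu.-integrable `[0, +oo[ (EFin \o (fun t => f t ^+ 2)) ->
      (\int[mu]_(x in `[0%R, +oo[) (f x ^+ 2)%:E < +oo)%E.
    move=> /integrableP[_]; apply: le_lt_trans; rewrite le_eqVlt; apply/orP; left.
    by apply/eqP/eq_integral => x _ /=; rewrite ger0_norm ?sqr_ge0.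
  split => //; split; first exact: sqE; split; first exact: sqE.
  move=> x x0; rewrite -ug//; first by rewrite addrC subrK.
  by move=> t /=; rewrite !in_itv/= andbT => /andP[].
Qed.

Variable u : gfun G.
Hypothesis u_H1 : inH1 u.

Definition core_int (F : R -> R) (f : 'I_(ne G) -> R -> R) : R :=
  \sum_e \int[mu]_(x in `[0, elen G e]) F (f e x).

Definition tail_int (a : R) (F f : R -> R) : R :=
  \int[mu]_(x in `[a, +oo[) F (f x).

Local Notation sq := (fun t : R => t ^+ 2).

Let elen_ge0 e : 0 <= elen G e. Proof. by rewrite ltW// G_valid.1. Qed.

Lemma gintE F f fhl : gint (G := G) F f fhl = core_int F f + tail_int 0 F fhl.
Proof. by []. Qed.

Lemma inH1_edge e : H1on `[0, elen G e] (fe u e) (de u e).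
Proof. by apply: H1_intervalP => //; exact: u_H1.2.1. Qed.

Lemma inH1_tail : H1on `[0, +oo[ (fh u) (dh u) /\
  mu.-integrable `[0, +oo[ (EFin \o (fun t => fh u t ^+ 2)).
Proof. exact/H1_halflineP/u_H1.2.2. Qed.

Lemma core_int_sq_ge0 f : 0 <= core_int sq f.
Proof. by apply: sumr_ge0 => e _; apply: Rintegral_ge0 => x _; exact: sqr_ge0. Qed.

Lemma tail_int_sq_ge0 a f : 0 <= tail_int a sq f.
Proof. by apply: Rintegral_ge0 => x _; exact: sqr_ge0. Qed.

Lemma inH1_core_osc x y : kpoint (G := G) x -> kpoint y ->
  (fe u x.1 x.2 - fe u y.1 y.2) ^+ 2 <= 9 * (core_diam G * core_int sq (de u)).
Proof.
have [[phi [uphi _]] _] := u_H1.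
apply: (core_osc G_valid (F := phi)) => //.
- by move=> e; apply: Rintegral_ge0 => t _; exact: sqr_ge0.
- move=> l l0 e s t s0 st tl.
  have sub : `[s, t] `<=` `[0, elen G e].
    by move=> r /=; rewrite !in_itv/= => /andP[sr rt]; apply/andP; split; lra.
  apply: le_trans (H1on_osc_amgm _ (inH1_edge e) l0 st sub) _ => //.
  rewrite lerD2l ler_pM2l ?invr_gt0//; apply: le_Rintegral_set => //.
    by move=> r _; exact: sqr_ge0.
  by have [_ ? _] := inH1_edge e.
Qed.

Lemma inH1_edge_sqr_var l e s t : 0 < l -> 0 <= s -> s <= t -> t <= elen G e ->
  `|fe u e t ^+ 2 - fe u e s ^+ 2| <=
    l * (\int[mu]_(x in `[0, elen G e]) fe u e x ^+ 2) +
    l^-1 * (\int[mu]_(x in `[0, elen G e]) de u e x ^+ 2).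
Proof.
move=> l0 s0 st tl.
have sub : `[s, t] `<=` `[0, elen G e].
  by move=> r /=; rewrite !in_itv/= => /andP[sr rt]; apply/andP; split; lra.
apply: le_trans (H1on_sqr_var _ (inH1_edge e) l0 st sub) _ => //.
apply: lerD.
  rewrite ler_pM2l//; apply: le_Rintegral_set => //.
    by move=> r _; exact: sqr_ge0.
  exact: (H1on_itv_integrable_sqr _ (inH1_edge e)).
rewrite ler_pM2l ?invr_gt0//; apply: le_Rintegral_set => //.
  by move=> r _; exact: sqr_ge0.
by have [_ ? _] := inH1_edge e.
Qed.

Let M := mass u.
Let K := gint (G := G) sq (de u) (dh u).

Lemma tail_sup l x : 0 < l -> 0 <= x ->
  fh u x ^+ 2 <= l * tail_int 0 sq (fh u) + l^-1 * tail_int 0 sq (dh u).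
Proof.
move=> l0 x0; have [H iu] := inH1_tail; have [_ ig _] := H.
have sub : `[x, +oo[ `<=` `[0, +oo[.
  by move=> t /=; rewrite !in_itv/= !andbT; lra.
apply: le_trans (H1on_halfline_sqr H iu l0 x0) _.
apply: lerD.
  by rewrite ler_pM2l//; apply: le_Rintegral_set => // t _; exact: sqr_ge0.
by rewrite ler_pM2l ?invr_gt0//; apply: le_Rintegral_set => // t _; exact: sqr_ge0.
Qed.

(** From the half-line bound at 0, the square varies along a simple walk in the core and then along
    part of one edge. That edge may be counted twice, whence the factor 2; the constant is the same
    for all graphs. *)
Lemma graph_sup l : 0 < l ->
  (forall x, kpoint (G := G) x -> fe u x.1 x.2 ^+ 2 <= 2 * (l * M + l^-1 * K)) /\
  (forall x, 0 <= x -> fh u x ^+ 2 <= 2 * (l * M + l^-1 * K)).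
Proof.
move=> l0; have li0 : 0 < l^-1 by rewrite invr_gt0.
rewrite /M /mass /K !gintE.
have c1 := core_int_sq_ge0 (fe u); have c2 := core_int_sq_ge0 (de u).
have t1 := tail_int_sq_ge0 0 (fh u); have t2 := tail_int_sq_ge0 0 (dh u).
have lc1 := mulr_ge0 (ltW l0) c1; have lc2 := mulr_ge0 (ltW li0) c2.
have lt1 := mulr_ge0 (ltW l0) t1; have lt2 := mulr_ge0 (ltW li0) t2.
split; last by move=> x x0; have := tail_sup l0 x0; lra.
move=> [e x] /= /andP[/= x0 xl].
have [[phi [uphi hphi]] _] := u_H1.
pose w e := l * (\int[mu]_(x in `[0, elen G e]) fe u e x ^+ 2) +
    l^-1 * (\int[mu]_(x in `[0, elen G e]) de u e x ^+ 2).
have wE : \sum_e w e = l * core_int sq (fe u) + l^-1 * core_int sq (de u).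
  by rewrite big_split/= -!mulr_sumr.
have phiw e' : `|phi (edst G e') ^+ 2 - phi (esrc G e') ^+ 2| <= w e'.
  rewrite -(uphi e').1 -(uphi e').2; apply: inH1_edge_sqr_var => //.
have w0 e' : 0 <= w e' by exact: le_trans (phiw e').
have we : w e <= \sum_e w e by rewrite (bigD1 e)//= lerDl sumr_ge0.
have h1 := @connected_var _ _ G_valid (fun v => phi v ^+ 2) _ (hv G) (esrc G e) phiw.
have h2 := @inH1_edge_sqr_var l e 0 x l0 (lexx _) x0 xl.
have h3 := tail_sup l0 (lexx 0); rewrite hphi in h3.
rewrite (uphi e).1 -/(w e) in h2; rewrite wE in h1 we.
move: h1 h2; rewrite !ler_norml => /andP[_ h1] /andP[_ h2]; lra.
Qed.

(** Averaging over the core: [a^2 <= 2 b^2 + 2 (a - b)^2] is integrated in the second point, and the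
    oscillation bound 9 becomes 18. *)
Lemma core_sup x : kpoint (G := G) x -> fe u x.1 x.2 ^+ 2 <=
  2 * core_int sq (fe u) / core_length G + 18 * (core_diam G * core_int sq (de u)).
Proof.
move=> kx; set DK := core_diam G * _; set c := fe u x.1 x.2 ^+ 2.
rewrite -lerBlDr ler_pdivlMr// /core_length mulr_sumr.
rewrite mulr_sumr; apply: ler_sum => e _.
have iu := H1on_itv_integrable_sqr _ (inH1_edge e) (elen_ge0 e) (@subset_refl _ _).
have {}iu := iu (measurable_itv _).
rewrite -RintegralZl// -[X in _ * X]subr0 -Rintegral_itv_cst//.
apply: le_Rintegral => //; first exact: integrable_itv_cst.
  exact: (integrableZl _ 2 iu).
move=> t /=; rewrite in_itv/= => /andP[t0 tl].
have := @inH1_core_osc x (e, t) kx; rewrite /kpoint/= t0 tl => /(_ isT).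
rewrite -/DK /c; set a := fe u x.1 x.2; set b := fe u e t.
by have := sqr_ge0 (a - 2 * b); nra.
Qed.

Lemma tail0_sup : fh u 0 ^+ 2 <=
  2 * core_int sq (fe u) / core_length G + 18 * (core_diam G * core_int sq (de u)).
Proof.
have [[phi [uphi hphi]] _] := u_H1.
have [e [ev|ev]] := vertex_on_core G_valid (hv G) core_gt0.
  have := @core_sup (e, 0); rewrite /kpoint/= lexx elen_ge0 (uphi e).1 ev hphi.
  by apply.
have := @core_sup (e, elen G e); rewrite /kpoint/= lexx elen_ge0 (uphi e).2 ev hphi.
by apply.
Qed.

Lemma core_powR_norm_le (p S : R) : 2 < p ->
  (forall x, kpoint (G := G) x -> fe u x.1 x.2 ^+ 2 <= S) ->
  core_int (fun t => `|t| `^ p) (fe u) <= S `^ ((p - 2) / 2) * core_int sq (fe u).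
Proof.
move=> p2 uS; rewrite /core_int mulr_sumr; apply: ler_sum => e _.
have H := inH1_edge e.
apply: (@integrable_powR_norm R `[0, elen G e] (fe u e) p S p2 _ _ _ _).2 => //.
- exact: (H1on_itv_measurable _ H).
- exact: (H1on_itv_integrable_sqr _ H).
- by move=> x xe; apply: (uS (e, x)); move: xe; rewrite /= in_itv.
Qed.

End GraphFunctions.

(** * Surgery on the half-line *)

Section HalfLineCompetitors.
Variables (R : realType) (p : R).
Hypothesis p2 : 2 < p.
Let p_gt0 : 0 < p. Proof. exact: lt_trans p2. Qed.
Let p_neq0 : p != 0. Proof. by rewrite gt_eqF. Qed.
Notation mu := (@lebesgue_measure R).
Local Notation sq := (fun t : R => t ^+ 2).
Local Notation pw := (fun t : R => `|t| `^ p).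
Implicit Types (w g F : R -> R).

Lemma pw_ge0 D w : 0 <= \int[mu]_(x in D) `|w x| `^ p.
Proof. by apply: Rintegral_ge0 => x _; exact: powR_ge0. Qed.

(** The second part serves to make the potential term of a tail vanish together with its mass; the
    value of [S] is immaterial. *)
Lemma H1_halfline_pw w g : H1_halfline w g ->
  mu.-integrable `[0, +oo[ (EFin \o (fun x => `|w x| `^ p)) /\
  exists S, forall a, 0 <= a -> tail_int a pw w <= S * tail_int a sq w.
Proof.
move=> /H1_halflineP[H iw]; have mw := H1on_halfline_measurable H.
pose S := \int[mu]_(t in `[0, +oo[) w t ^+ 2 + \int[mu]_(t in `[0, +oo[) g t ^+ 2.
have [_ ig _] := H.
have wS x : `[0, +oo[%classic x -> w x ^+ 2 <= S.
  rewrite /= in_itv/= andbT => x0.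
  have := H1on_halfline_sqr H iw ltr01 x0; rewrite invr1 !mul1r => /le_trans; apply.
  have sub : `[x, +oo[ `<=` `[0, +oo[.
    by move=> t /=; rewrite !in_itv/= !andbT; lra.
  by apply: lerD; apply: le_Rintegral_set => // t _; exact: sqr_ge0.
split; first exact: (integrable_powR_norm p2 _ mw iw wS).1.
exists (S `^ ((p - 2) / 2)) => a a0.
have sub : `[a, +oo[ `<=` `[0, +oo[.
  by move=> t /=; rewrite !in_itv/= !andbT; lra.
apply: (integrable_powR_norm p2 _ _ _ _).2 => //.
- exact: measurable_funS mw.
- exact: integrableS iw.
- by move=> x /sub; exact: wS.
Qed.

Lemma tail_int_split F w a : 0 <= a ->
  mu.-integrable `[0, +oo[ (EFin \o (fun x => F (w x))) ->
  tail_int 0 F w = \int[mu]_(x in `[0, a]) F (w x) + tail_int a F w.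
Proof. by move=> a0 iF; rewrite /tail_int (Rintegral_split a0). Qed.

Lemma tail_int_shift F w a : 0 <= a ->
  mu.-integrable `[0, +oo[ (EFin \o (fun x => F (w x))) ->
  mu.-integrable `[0, +oo[ (EFin \o (fun x => F (w (x + a)))) /\
  tail_int 0 F (fun x => w (x + a)) = tail_int a F w.
Proof.
move=> a0 iF.
have [] := @Rintegral_shift R a (BLeft 0) (BInfty R false) (fun x => F (w x)).
  apply: integrableS iF => //=; rewrite add0r.
  by move=> t /=; rewrite !in_itv/= !andbT; lra.
by rewrite /= add0r.
Qed.

Lemma H1_halfline_shift w g a : 0 <= a -> H1_halfline w g ->
  H1_halfline (fun x => w (x + a)) (fun x => g (x + a)).
Proof.
move=> a0 /H1_halflineP[H iw]; apply/H1_halflineP; split; first exact: H1on_shift.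
by have [] := @tail_int_shift sq w a a0 iw.
Qed.

Lemma tail_int_glue F a f1 f2 : 0 <= a ->
  mu.-integrable `[0, a] (EFin \o (fun x => F (f1 x))) ->
  mu.-integrable `[0, +oo[ (EFin \o (fun x => F (f2 x))) ->
  mu.-integrable `[0, +oo[ (EFin \o (fun x => F (glueat a f1 f2 x))) /\
  tail_int 0 F (glueat a f1 f2) = \int[mu]_(x in `[0, a]) F (f1 x) + tail_int 0 F f2.
Proof.
move=> a0 i1 i2.
have E : (fun x => F (glueat a f1 f2 x)) =
    glueat a (fun x => F (f1 x)) (fun x => F (f2 x)).
  by apply/funext => x; rewrite /glueat; case: ifP.
by rewrite /tail_int E; exact: (@Rintegral_glue R a (BInfty R false)).
Qed.

(* [w] is [w2] pushed to the right by [L], preceded by an affine piece starting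
   at height [A]. *)
Lemma H1_halfline_ramp (A L : R) w2 g2 : 0 < L -> H1_halfline w2 g2 ->
  exists w g,
  [/\ H1_halfline w g,
      forall x, 0 <= x <= L -> w x = A + (w2 0 - A) / L * x,
      tail_int 0 sq g = (w2 0 - A) ^+ 2 / L + tail_int 0 sq g2,
      tail_int 0 sq w2 <= tail_int 0 sq w <=
        tail_int 0 sq w2 + L * (A ^+ 2 + w2 0 ^+ 2) &
      tail_int 0 pw w2 <= tail_int 0 pw w].
Proof.
move=> L0 Hw2; have /H1_halflineP[H2 i2] := Hw2.
pose c := w2 0; pose f1 x := A + (c - A) / L * x.
exists (glueat L f1 w2), (glueat L (fun=> (c - A) / L) g2).
have L0' := ltW L0; have Ln0 : L != 0 by rewrite gt_eqF.
have H1 : H1on `[0, L] f1 (fun=> (c - A) / L) by exact: H1on_affine.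
have f1L : f1 L = w2 0 by rewrite /f1 divfK// addrC subrK.
have H := H1on_glue L0' f1L H1 H2.
have i1 : mu.-integrable `[0, L] (EFin \o (fun x => f1 x ^+ 2)).
  exact: (H1on_itv_integrable_sqr _ H1).
have f1_bound x : `[0, L]%classic x -> f1 x ^+ 2 <= A ^+ 2 + c ^+ 2.
  rewrite /= in_itv/= => /andP[x0 xL].
  have -> : f1 x = A * (1 - x / L) + c * (x / L) by rewrite /f1; field.
  have s0 : 0 <= x / L by rewrite divr_ge0.
  have s1 : x / L <= 1 by rewrite ler_pdivrMr// mul1r.
  have {}s1 : 0 <= 1 - x / L by rewrite subr_ge0.
  move: (x / L) s0 s1 => s s0 s1.
  (* Convexity of the square, with the remainder written as a sum of nonnegative terms. *)
  have -> : A ^+ 2 + c ^+ 2 = (A * (1 - s) + c * s) ^+ 2 +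
    (s * (1 - s) * (A - c) ^+ 2 + (s * A ^+ 2 + (1 - s) * c ^+ 2)) by ring.
  rewrite lerDl; apply: addr_ge0; last apply: addr_ge0.
  - by rewrite mulr_ge0 ?sqr_ge0// mulr_ge0.
  - by rewrite mulr_ge0 ?sqr_ge0.
  - by rewrite mulr_ge0 ?sqr_ge0.
have [iw mw] := tail_int_glue (F := sq) L0' i1 i2.
have [_ ig2 _] := H2.
have [_ kw] := @tail_int_glue sq L (fun=> (c - A) / L) g2 L0'
  (integrable_itv_cst 0 L (((c - A) / L) ^+ 2)) ig2.
have [ip2 _] := H1_halfline_pw Hw2.
have ip1 : mu.-integrable `[0, L] (EFin \o (fun x => `|f1 x| `^ p)).
  apply: (integrable_powR_norm p2 _ _ i1 f1_bound).1 => //.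
  exact: (H1on_itv_measurable _ H1).
have [_ pww] := tail_int_glue (F := pw) L0' ip1 ip2.
split.
- by apply/H1_halflineP; split.
- by move=> x /andP[_ xL]; rewrite /glueat xL.
- by rewrite kw Rintegral_itv_cst// subr0 -/c; congr (_ + _); field.
- rewrite mw lerDr addrC lerD2l; apply/andP; split.
    by apply: Rintegral_ge0 => x _; exact: sqr_ge0.
  rewrite mulrC -[X in _ * X]subr0 -Rintegral_itv_cst//.
  by apply: le_Rintegral => //; exact: integrable_itv_cst.
- by rewrite pww lerDr pw_ge0.
Qed.

Lemma H1_halfline0 : H1_halfline (fun=> 0 : R) (fun=> 0 : R).
Proof.
have i0 : mu.-integrable `[0, +oo[ (EFin \o (fun=> (0 : R) ^+ 2)).
  rewrite (_ : EFin \o _ = cst 0%E); last by apply/funext => x /=; rewrite expr0n.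
  exact: integrable0.
apply/H1_halflineP; split => //; split => //.
by move=> x y xy _; rewrite Rintegral_itv_cst// mul0r subrr.
Qed.

Lemma tail_int0 F : F 0 = 0 -> tail_int 0 F (fun=> 0) = 0.
Proof.
move=> F0; rewrite /tail_int /Rintegral integral0_eq// => x _; by rewrite F0.
Qed.

(** Two ramps of length [l]: one going down from 1 to 0 in front of the zero function, then one
    going up from 0 to 1 in front of the first. The potential bound uses the upper half of the
    rising ramp only, where the function is at least 1/2. *)
Lemma tent (l : R) : 0 < l -> exists w g, [/\ H1_halfline w g, w 0 = 0,
  0 < tail_int 0 sq w <= 2 * l, tail_int 0 sq g = 2 / l &
  l / 2 * 2^-1 `^ p <= tail_int 0 pw w].
Proof.
move=> l0; have ln0 : l != 0 by rewrite gt_eqF.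
have [w2 [g2 [Hd wd kd /andP[_ md] _]]] := H1_halfline_ramp 1 l0 H1_halfline0.
have d0 : w2 0 = 1 by rewrite wd ?lexx ?(ltW l0)// mulr0 addr0.
have [w [g [Hw ww kw /andP[_ mw] _]]] := H1_halfline_ramp 0 l0 Hd.
have w0 : w 0 = 0 by rewrite ww ?lexx ?(ltW l0)// mulr0 addr0.
have sq0 : sq 0 = 0 by rewrite expr0n.
have [ip [S wS]] := H1_halfline_pw Hw.
have pwl : l / 2 * 2^-1 `^ p <= tail_int 0 pw w.
  rewrite mulrC (_ : l / 2 = l - l / 2); last by field.
  have l20 : 0 <= l / 2 by rewrite divr_ge0// ltW.
  have sub : `[l / 2, l] `<=` `[0, +oo[.
    by move=> x /=; rewrite !in_itv/= andbT => /andP[+ _]; exact: le_trans.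
  rewrite -Rintegral_itv_cst; last lra.
  apply: (@le_trans _ _ (\int[mu]_(x in `[l / 2, l]) `|w x| `^ p)); last first.
    by apply: le_Rintegral_set => // x _; exact: powR_ge0.
  apply: le_Rintegral => //; [exact: integrable_itv_cst|exact: integrableS ip|].
  move=> x; rewrite /= in_itv/= => /andP[lx xl].
  have x2 : 2^-1 <= x / l by rewrite ler_pdivlMr//; lra.
  have x0 : 0 <= x by exact: le_trans lx; rewrite divr_ge0// ltW.
  have -> : w x = x / l by rewrite ww ?x0// d0 subr0 add0r; field.
  rewrite ger0_norm; last by apply: le_trans x2; rewrite invr_ge0.
  apply: ge0_ler_powR => //; rewrite ?nnegrE ?invr_ge0//; first exact: ltW.
  by apply: le_trans x2; rewrite invr_ge0.
have mpos : 0 < tail_int 0 sq w.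
  rewrite lt_neqAle tail_int_sq_ge0 andbT; apply/eqP => m0.
  have := wS 0 (lexx _); rewrite -m0 mulr0 leNgt => /negP; apply.
  apply: lt_le_trans pwl; rewrite mulr_gt0 ?powR_gt0//; lra.
exists w, g; split => //.
- rewrite mpos/=; apply: le_trans mw _.
  rewrite d0 expr0n/= expr1n add0r mulr1.
  by move: md; rewrite (tail_int0 (F := sq) sq0) expr1n expr0n/= addr0 mulr1 add0r; lra.
- rewrite kw kd (tail_int0 (F := sq) sq0) d0 addr0 sub0r sqrrN subr0 expr1n; by field.
Qed.

End HalfLineCompetitors.

(** The suffixes [r] and [t] mark the removed part and the kept tail; [Mw], [Kw], [Pw] belong to the
    ramped competitor, whose ramp adds mass at most [A] and kinetic energy [B]. The factor of
    [mr - A] is the price of a unit of mass: it plays the part of a Lagrange multiplier. *)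
Lemma cut_arith (R : realType) (p m0 E mr mt kr kt pr pt A B Mw Kw Pw : R) :
  2 < p -> 0 < m0 -> mr + mt = m0 ->
  E = (kr + kt) / 2 - (pr + pt) / p ->
  0 <= mt -> 0 <= kt -> 0 <= pt -> (mt = 0 -> pt = 0) -> pt <= Pw ->
  mt <= Mw -> Mw <= mt + A -> 0 <= B -> Kw = B + kt ->
  (0 < Mw -> E <= m0 / Mw / 2 * Kw - (m0 / Mw) `^ (p / 2) * Pw / p) ->
  0 <= - E + (p - 2) / 2 * (pt / p) ->
  (mr - A) * ((- E + (p - 2) / 2 * (pt / p)) / m0) + kr / 2 <= pr / p + B / 2.
Proof.
move=> p2 m0_gt0 mE EE mt0 kt0 pt0 mtpt ptw mw1 mw2 B0 kw comp Lam0.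
have p0 : 0 < p by lra.
have [Mw0|Mw0] := ltP 0 Mw; last first.
  have mt_0 : mt = 0 by lra.
  have pt_0 := mtpt mt_0.
  rewrite pt_0 mul0r mulr0 addr0 in EE Lam0 *.
  have : (mr - A) * (- E / m0) <= - E.
    rewrite mulrA ler_pdivrMr// mulrC ler_wpM2l//; lra.
  lra.
have := comp Mw0; set t := m0 / Mw.
have t0 : 0 < t by rewrite divr_gt0.
(* Once divided by [t], this lower bound is affine in [t^-1 = Mw / m0], so the comparison becomes
   linear in the mass exchanged. *)
have tp : t * (1 - (p - 2) / 2 * (t^-1 - 1)) <= t `^ (p / 2).
  have -> : p / 2 = 1 + (p - 2) / 2 by field.
  rewrite powRD; last by rewrite (gt_eqF t0) implybT.
  rewrite powRr1 ?(ltW t0)// ler_pM2l//; apply: powR_bernoulli => //.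
  by rewrite divr_gt0// subr_gt0.
have h1 : t `^ (p / 2) * pt <= t `^ (p / 2) * Pw by rewrite ler_wpM2l// powR_ge0.
have h2 := le_trans (ler_wpM2r pt0 tp) h1.
have sE : t^-1 = Mw / m0 by rewrite invf_div.
move: (t `^ (p / 2)) h2 => T h2 {h1 tp} comp1.
have h3 : t * (1 - (p - 2) / 2 * (t^-1 - 1)) * pt / p <= T * Pw / p.
  by rewrite ler_pM2r ?invr_gt0.
have comp2 : E <= t * (Kw / 2 - (1 - (p - 2) / 2 * (t^-1 - 1)) * (pt / p)).
  by apply: le_trans comp1 _; clear -h3; lra.
have {}comp2 : t^-1 * E <= Kw / 2 - (1 - (p - 2) / 2 * (t^-1 - 1)) * (pt / p).
  by rewrite -ler_pdivlMl ?invr_gt0// invrK.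
have key : (1 - t^-1) * (- E + (p - 2) / 2 * (pt / p)) <= pr / p + B / 2 - kr / 2.
  have -> : (1 - t^-1) * (- E + (p - 2) / 2 * (pt / p)) =
    t^-1 * E - E - (p - 2) / 2 * (t^-1 - 1) * (pt / p) by ring.
  move: comp2 EE; rewrite kw.
  by move: (t^-1 * E) ((p - 2) / 2 * (t^-1 - 1)) => X Y; clear; lra.
have : (mr - A) * ((- E + (p - 2) / 2 * (pt / p)) / m0) <=
    (1 - t^-1) * (- E + (p - 2) / 2 * (pt / p)).
  move: (- E + _) Lam0 => Lam Lam0.
  have -> : (mr - A) * (Lam / m0) = (mr - A) / m0 * Lam by ring.
  rewrite ler_wpM2r// ler_pdivrMr// sE mulrBl mul1r divfK ?gt_eqF//.
  by clear -mE mw1 mw2; lra.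
by clear -key; lra.
Qed.

(** * Comparison of a ground state with competitors carried by the half-line *)

Section GroundState.
Variables (R : realType) (G : mgraph R) (p m0 : R) (u : gfun G).
Hypothesis p2 : 2 < p.
Let p_gt0 : 0 < p. Proof. exact: lt_trans p2. Qed.
Let p_neq0 : p != 0. Proof. by rewrite gt_eqF. Qed.
Hypothesis m0_gt0 : 0 < m0.
Hypothesis u_gs : ground_state p m0 u.
Notation mu := (@lebesgue_measure R).
Local Notation sq := (fun t : R => t ^+ 2).
Local Notation pw := (fun t : R => `|t| `^ p).
Let E := energy p u.
Let u_H1 : inH1 u := u_gs.1.1.

Definition zero_ext (w g : R -> R) : gfun G :=
  GFun (fun _ _ => 0) (fun _ _ => 0) w g.

Lemma core_int0 F : F 0 = 0 -> core_int (G := G) F (fun _ _ => 0) = 0.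
Proof.
move=> F0; rewrite /core_int big1// => e _.
by rewrite /Rintegral integral0_eq// => x _; rewrite F0.
Qed.

Lemma inH1_zero_ext w g : H1_halfline w g -> w 0 = 0 -> inH1 (zero_ext w g).
Proof.
move=> Hw w0; split; first by exists (fun=> 0).
split => // e; split; first exact: measurable_cst.
split; first by rewrite integral0_eq ?ltry// => x _; rewrite expr0n.
by move=> x /andP[x0 _]; rewrite add0r /leb /seg Rintegral_itv_cst// mul0r.
Qed.

(* The amplitude of [w] is rescaled to reach the mass [m0]. *)
Lemma competitor w g : H1_halfline w g -> w 0 = 0 -> 0 < tail_int 0 sq w ->
  E <= m0 / tail_int 0 sq w / 2 * tail_int 0 sq g
    - (m0 / tail_int 0 sq w) `^ (p / 2) * tail_int 0 pw w / p.
Proof.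
move=> Hw w0 mw; set t := m0 / _; have t0 : 0 < t by rewrite divr_gt0.
have /H1_halflineP[H iw] := Hw; have [_ ig _] := H.
have [ip _] := H1_halfline_pw p2 Hw.
pose s := Num.sqrt t; have s2 : s ^+ 2 = t by rewrite sqr_sqrtr// ltW.
pose w' x := s * w x; pose g' x := s * g x.
have mw' : tail_int 0 sq w' = t * tail_int 0 sq w.
  rewrite /tail_int -RintegralZl//; apply: eq_Rintegral => x _.
  by rewrite exprMn s2.
have kw' : tail_int 0 sq g' = t * tail_int 0 sq g.
  rewrite /tail_int -RintegralZl//; apply: eq_Rintegral => x _.
  by rewrite exprMn s2.
have pw' : tail_int 0 pw w' = t `^ (p / 2) * tail_int 0 pw w.
  rewrite /tail_int -RintegralZl//; apply: eq_Rintegral => x _.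
  rewrite normrM powRM// ger0_norm ?sqrtr_ge0// /s -powR12_sqrt ?(ltW t0)//.
  by rewrite -powRrM [2^-1 * p]mulrC.
have Hw' : H1_halfline w' g'.
  apply/H1_halflineP; split; first exact: H1on_scale.
  rewrite (_ : (fun x => w' x ^+ 2) = (fun x => t * w x ^+ 2)).
    exact: (integrableZl _ t iw).
  by apply/funext => x; rewrite exprMn s2.
have sq0 : sq 0 = 0 by rewrite expr0n.
have pw0 : pw 0 = 0 by rewrite normr0 powR0.
have w'0 : w' 0 = 0 by rewrite /w' w0 mulr0.
have v_mass : inH1_mass m0 (zero_ext w' g').
  split; first exact: inH1_zero_ext.
  by rewrite /mass gintE/= core_int0// add0r mw' divfK// gt_eqF.
apply: le_trans (u_gs.2 _ v_mass) _; rewrite /energy !gintE/= !core_int0// !add0r.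
rewrite kw' pw' le_eqVlt; apply/orP; left; apply/eqP; field.
by [].
Qed.

(* The function [fh u] on [[a, +oo[], preceded by an affine ramp of length [L]
   from [0], against [u]; the quantities [mr], [kr] and [pr] are those of the
   part of [u] which is thrown away. *)
Lemma ground_state_cut (a L : R) : 0 <= a -> 0 < L ->
  let c := fh u a in
  let mr := core_int sq (fe u) + \int[mu]_(x in `[0, a]) fh u x ^+ 2 in
  let kr := core_int sq (de u) + \int[mu]_(x in `[0, a]) dh u x ^+ 2 in
  let pr := core_int pw (fe u) + \int[mu]_(x in `[0, a]) `|fh u x| `^ p in
  let Lam := - E + (p - 2) / 2 * (tail_int a pw (fh u) / p) in
  0 <= Lam ->
  (mr - L * c ^+ 2) * (Lam / m0) + kr / 2 <= pr / p + c ^+ 2 / (2 * L).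
Proof.
move=> a0 L0 c mr kr pr Lam Lam0.
have p0 := p_gt0.
have Hh := u_H1.2.2; have /H1_halflineP[H iu] := Hh; have [_ ig _] := H.
have [ip [S uS]] := H1_halfline_pw p2 Hh.
have Hs := H1_halfline_shift a0 Hh.
have [w [g [Hw ww kw /andP[mw1 mw2] ptw]]] := H1_halfline_ramp p2 0 L0 Hs.
have w0 : w 0 = 0 by rewrite ww ?lexx ?(ltW L0)// mulr0 addr0.
rewrite (tail_int_shift (F := sq) a0 iu).2 add0r -/c in mw1 mw2.
rewrite (tail_int_shift (F := sq) a0 ig).2 add0r subr0 -/c in kw.
rewrite (tail_int_shift (F := pw) a0 ip).2 in ptw.
have mE : mr + tail_int a sq (fh u) = m0.
  rewrite -u_gs.1.2 /mass gintE (tail_int_split (F := sq) a0 iu) /mr; ring.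
have EE : E = (kr + tail_int a sq (dh u)) / 2 - (pr + tail_int a pw (fh u)) / p.
  rewrite /E /energy !gintE (tail_int_split (F := sq) a0 ig).
  by rewrite (tail_int_split (F := pw) a0 ip) /kr /pr; field.
have mt0 : 0 <= tail_int a sq (fh u) by exact: tail_int_sq_ge0.
have kt0 : 0 <= tail_int a sq (dh u) by exact: tail_int_sq_ge0.
have pt0 : 0 <= tail_int a pw (fh u) by exact: pw_ge0.
rewrite expr0n add0r in mw2.
have Lc : c ^+ 2 / (2 * L) = c ^+ 2 / L / 2 by field; rewrite gt_eqF.
rewrite Lc; apply: (@cut_arith _ p m0 E mr (tail_int a sq (fh u)) kr
  (tail_int a sq (dh u)) pr (tail_int a pw (fh u)) (L * c ^+ 2) (c ^+ 2 / L)
  (tail_int 0 sq w) (tail_int 0 sq g) (tail_int 0 pw w)) => //.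
- by move=> mt_0; apply/eqP; rewrite eq_le pt0 andbT; have := uS a a0; rewrite mt_0 mulr0.
- by rewrite divr_ge0 ?sqr_ge0// ltW.
- exact: competitor.
Qed.

End GroundState.

(** * Bounds depending on [p] only *)

Lemma double_add_le (R : realType) (y z : R) : z <= y -> 2 * (y + z) <= 4 * y.
Proof. lra. Qed.

Lemma double_sub_le (R : realType) (y z : R) : 4 * y <= z -> 2 * y - z <= - (2 * y).
Proof. lra. Qed.

Section UniformBounds.
Variables (R : realType) (p : R).
Hypothesis p26 : 2 < p < 6.
Let p2 : 2 < p. Proof. by case/andP: p26. Qed.
Let p6 : p < 6. Proof. by case/andP: p26. Qed.
Let p_gt0 : 0 < p. Proof. exact: lt_trans p2. Qed.
Let r := (p - 2) / 2.
Let r0 : 0 < r. Proof. by rewrite divr_gt0// subr_gt0. Qed.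
Let r2 : r < 2. Proof.
by rewrite /r ltr_pdivrMr// ltrBlDr (_ : 2 * 2 + 2 = 6 :> R)//; ring.
Qed.
Let r20 : 0 < 2 - r. Proof. by rewrite subr_gt0. Qed.
Local Notation sq := (fun t : R => t ^+ 2).
Local Notation pw := (fun t : R => `|t| `^ p).
Notation mu := (@lebesgue_measure R).

(** This identity singles out [beta]: [(1 + beta p) * (p - 2) / 2 = 2 * beta p]. A squared amplitude
    of order [m s] thus gives a potential energy of order [m s^2], like the kinetic one. *)
Lemma powR_mass_scale (m : R) : 0 < m ->
  (m * m `^ beta p) `^ ((p - 2) / 2) = (m `^ beta p) ^+ 2.
Proof.
move=> m0; have mn0 : m != 0 by rewrite gt_eqF.
have -> : m * m `^ beta p = m `^ (1 + beta p).
  by rewrite powRD ?mn0 ?implybT// powRr1// ltW.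
have -> : (m `^ beta p) ^+ 2 = m `^ (beta p * 2%:R).
  by rewrite powRrM powR_mulrn// powR_ge0.
rewrite -powRrM; have -> // : (1 + beta p) * ((p - 2) / 2) = beta p * 2%:R.
have p6' : 6 - p != 0 by rewrite subr_eq0 gt_eqF.
by rewrite /beta; field.
Qed.

(** Since [p < 6] means [r < 2], a wide enough tent has negative energy. It lives on the half-line,
    so [c] is fixed before the graph. *)
Lemma ground_state_energy_le : exists2 c : R, 0 < c &
  forall (G : mgraph R) (m : R) (u : gfun G), valid_graph G -> 0 < m ->
    ground_state p m u -> energy p u <= - (c * (m * (m `^ beta p) ^+ 2)).
Proof.
(* For the tent of half-width [Z / (2 s)], this [Z] makes the potential term
   twice as large as the kinetic one. *)
pose kap := 2^-1 `^ p / p.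
have kap0 : 0 < kap by rewrite divr_gt0// powR_gt0// invr_gt0.
pose Z := (16 / kap) `^ ((2 - r)^-1).
have Z0 : 0 < Z by rewrite powR_gt0// divr_gt0.
have Zr : Z ^+ 2 * kap = 16 * Z `^ r.
  have -> : Z ^+ 2 = Z `^ (2 - r) * Z `^ r.
    rewrite -powRD; last by rewrite (gt_eqF Z0) implybT.
    by rewrite subrK powR_mulrn// ltW.
  rewrite /Z -powRrM mulVf ?powRr1; first by field; rewrite gt_eqF.
    by rewrite ltW// divr_gt0.
  by rewrite gt_eqF.
exists (2 / Z ^+ 2); first by rewrite divr_gt0// exprn_gt0.
move=> G m u G_valid m0 u_gs.
have sr := powR_mass_scale m0; rewrite -/r in sr.
have s0 : 0 < m `^ beta p by exact: powR_gt0.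
move: (m `^ beta p) sr s0 => s sr s0.
have l0 : 0 < Z / (2 * s) by rewrite divr_gt0// mulr_gt0.
have [w [g [Hw w0 /andP[mw0 mw] kw pww]]] := tent p2 l0.
apply: le_trans (competitor p2 m0 u_gs Hw w0 mw0) _.
rewrite kw; set t := m / _.
(* The tent has mass at most [Z / s]. *)
have t1 : m * s / Z <= t.
  rewrite /t ler_pdivlMr// mulrAC ler_pdivrMr//.
  have : m * s * tail_int 0 sq w <= m * s * (2 * (Z / (2 * s))).
    by rewrite ler_pM2l// mulr_gt0.
  by move=> /le_trans; apply; rewrite le_eqVlt; apply/orP; left; apply/eqP; field; rewrite gt_eqF.
have t10 : 0 < m * s / Z by rewrite divr_gt0// mulr_gt0.
have t0 : 0 < t by exact: lt_le_trans t1.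
have tp : t `^ (p / 2) = t * t `^ r.
  have -> : p / 2 = 1 + r by rewrite /r; field.
  by rewrite powRD ?powRr1 ?(ltW t0)// (gt_eqF t0) implybT.
have W0 : 0 < Z `^ r by exact: powR_gt0.
have tr : s ^+ 2 / Z `^ r <= t `^ r.
  rewrite ler_pdivrMr// -sr -powRM ?(ltW t0) ?(ltW Z0)//.
  have ms := ltW (mulr_gt0 m0 s0); have tZ := ltW (mulr_gt0 t0 Z0).
  by apply: (ge0_ler_powR (ltW r0)); rewrite ?nnegrE// -ler_pdivrMr.
have kapE : kap = 16 * Z `^ r / Z ^+ 2.
  by rewrite -Zr mulrAC divff ?mul1r// gt_eqF// exprn_gt0.
rewrite tp.
move: (t `^ r) (Z `^ r) (tail_int 0 pw w) W0 tr kapE pww => T W P W0 tr kapE pww.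
have h0 : Z / (2 * s) / 2 * kap <= P / p by rewrite /kap mulrA ler_pM2r// invr_gt0.
have kap' : 0 <= Z / (2 * s) / 2 * kap.
  by rewrite mulr_ge0 ?(ltW kap0)// divr_ge0// ltW.
have h1 : 4 * (s / Z) <= T * (P / p).
  have -> : 4 * (s / Z) = s ^+ 2 / W * (Z / (2 * s) / 2 * kap).
    by rewrite kapE; field; rewrite !gt_eqF.
  by apply: ler_pM => //; exact: divr_ge0 (sqr_ge0 s) (ltW W0).
have -> : t / 2 * (2 / (Z / (2 * s))) - t * T * P / p =
    t * (2 * (s / Z) - T * (P / p)).
  by field; rewrite !gt_eqF.
have sZ : 0 < s / Z by exact: divr_gt0.
have h2 : t * (2 * (s / Z) - T * (P / p)) <= t * (- (2 * (s / Z))).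
  by rewrite ler_pM2l//; exact: double_sub_le.
apply: le_trans h2 _; rewrite mulrN lerN2.
have -> : 2 / Z ^+ 2 * (m * s ^+ 2) = m * s / Z * (2 * (s / Z)).
  by field; rewrite gt_eqF.
by rewrite ler_pM2r// mulr_gt0.
Qed.

(** Subcriticality [r < 2] closes this self-referential bound. *)
Lemma powR_solve (x : R) : 1 <= x -> x ^+ 2 <= (4 * x) `^ r -> x <= 4 `^ (r / (2 - r)).
Proof.
move=> x1 xr; have x0 : 0 < x by exact: lt_le_trans x1.
have h : x `^ (2 - r) <= 4 `^ r.
  have xr0 : 0 < x `^ r by exact: powR_gt0.
  rewrite -(ler_pM2r xr0) -powRD; last by rewrite (gt_eqF x0) implybT.
  by rewrite subrK powR_mulrn ?(ltW x0)// -powRM// ltW.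
have -> : x = (x `^ (2 - r)) `^ (2 - r)^-1.
  by rewrite -powRrM divff ?gt_eqF// powRr1// ltW.
rewrite powRrM; apply: ge0_ler_powR; rewrite ?nnegrE ?powR_ge0//.
by rewrite invr_ge0 ltW.
Qed.

Lemma gint_pw_le (G : mgraph R) (u : gfun G) (S : R) : valid_graph G -> inH1 u ->
  (forall x, kpoint (G := G) x -> fe u x.1 x.2 ^+ 2 <= S) ->
  (forall x, 0 <= x -> fh u x ^+ 2 <= S) ->
  gint (G := G) pw (fe u) (fh u) <= S `^ r * mass u.
Proof.
move=> G_valid u_H1 cS hS; rewrite /mass !gintE mulrDr; apply: lerD.
  exact: core_powR_norm_le.
have [H iu] := inH1_tail u_H1.
apply: (integrable_powR_norm p2 _ _ iu _).2 => //.
  exact: (H1on_halfline_measurable H).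
by move=> x; rewrite /= in_itv/= andbT => x0; exact: hS.
Qed.

(** Nonpositive energy bounds the kinetic term by the potential one, which the sup bound controls by
    the power [r < 2] of the normalised kinetic size [x]; [powR_solve] concludes. *)
Lemma apriori : exists2 X : R, 1 <= X &
  forall (G : mgraph R) (m : R) (u : gfun G), valid_graph G -> 0 < m ->
    ground_state p m u -> energy p u <= 0 ->
    let s := m `^ beta p in
    [/\ gint (G := G) sq (de u) (dh u) <= X ^+ 2 * (m * s ^+ 2),
        forall x, kpoint (G := G) x -> fe u x.1 x.2 ^+ 2 <= 4 * X * (m * s) &
        forall x, 0 <= x -> fh u x ^+ 2 <= 4 * X * (m * s)].
Proof.
pose X := (4 : R) `^ (r / (2 - r)).
have X1 : 1 <= X.
  rewrite -(powRr0 4) /X; apply: ler_powR; first lra.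
  by rewrite divr_ge0// ltW.
exists X => // G m u G_valid m0 u_gs E0 s.
have u_H1 := u_gs.1.1; have um := u_gs.1.2.
have sr := powR_mass_scale m0; rewrite -/r -/s in sr.
have s0 : 0 < s by exact: powR_gt0.
have sup := graph_sup G_valid u_H1; rewrite um in sup.
have pint := gint_pw_le G_valid u_H1; rewrite um in pint.
move: E0; rewrite /energy.
have k0 : 0 <= gint (G := G) sq (de u) (dh u).
  by rewrite gintE addr_ge0// ?core_int_sq_ge0// tail_int_sq_ge0.
move: (gint sq _ _) sup k0 => k sup k0.
move: (gint _ _ _) pint => P pint EP.
move: s s0 sr => s s0 sr in pint sup *.
have ms0 : 0 < m * s by rewrite mulr_gt0.
have ms20 : 0 < m * s ^+ 2 by rewrite mulr_gt0// exprn_gt0.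
(* The maximum with 1 ensures a positive weight and the hypothesis [1 <= x] of [powR_solve]. *)
pose x := Num.sqrt (Num.max (k / (m * s ^+ 2)) 1).
have x2 : x ^+ 2 = Num.max (k / (m * s ^+ 2)) 1.
  by rewrite sqr_sqrtr// le_max ler01 orbT.
have x0 : 0 <= x by exact: sqrtr_ge0.
have x1 : 1 <= x.
  by rewrite -(@ler_pXn2r _ 2)// ?nnegrE// expr1n x2 le_max lexx orbT.
have xgt0 : 0 < x by exact: lt_le_trans x1.
have kx : k <= x ^+ 2 * (m * s ^+ 2).
  by rewrite -ler_pdivrMr// x2 le_max lexx.
(* The weight [l = s * x] balances the mass and kinetic terms of the sup bound. *)
have supx : 2 * (s * x * m + (s * x)^-1 * k) <= 4 * x * (m * s).
  have sx0 : 0 < s * x by rewrite mulr_gt0.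
  have : (s * x)^-1 * k <= (s * x)^-1 * (x ^+ 2 * (m * s ^+ 2)).
    by rewrite ler_pM2l ?invr_gt0.
  have -> : (s * x)^-1 * (x ^+ 2 * (m * s ^+ 2)) = x * (m * s).
    by field; rewrite !gt_eqF.
  have -> : s * x * m = x * (m * s) by ring.
  have -> : 4 * x * (m * s) = 4 * (x * (m * s)) by ring.
  exact: double_add_le.
have [csup hsup] := sup (s * x) (mulr_gt0 s0 xgt0).
have Px : P <= (4 * x) `^ r * (m * s ^+ 2).
  have := pint (4 * x * (m * s)) (fun y ky => le_trans (csup y ky) supx)
    (fun y y0 => le_trans (hsup y y0) supx).
  rewrite powRM ?(ltW ms0) ?mulr_ge0 ?(ltW xgt0)// sr => /le_trans; apply.
  by rewrite le_eqVlt; apply/orP; left; apply/eqP; ring.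
have xX : x <= X.
  have [k1|k1] := leP (k / (m * s ^+ 2)) 1.
    have -> : x = 1 by rewrite /x (max_idPr k1) sqrtr1.
    exact: X1.
  apply: powR_solve => //; rewrite x2 (max_idPl (ltW k1)) ler_pdivrMr//.
  apply: le_trans Px.
  have P0 : k <= (2 / p) * P.
    have -> : 2 / p * P = 2 * (p^-1 * P) by ring.
    by lra.
  have P00 : 0 <= P.
    have := le_trans k0 P0; rewrite pmulr_rge0// divr_gt0//.
  apply: le_trans P0 _; rewrite -[leRHS]mul1r ler_wpM2r// ler_pdivrMr// mul1r; exact: ltW.
have xXs y : y <= 2 * (s * x * m + (s * x)^-1 * k) -> y <= 4 * X * (m * s).
  move=> /le_trans; apply; apply: le_trans supx _.
  by rewrite ler_pM2r// ler_pM2l.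
split.
- apply: le_trans kx _; rewrite ler_pM2r//.
  by rewrite ler_pXn2r// nnegrE (le_trans _ xX).
- by move=> y ky; apply: xXs; exact: csup.
- by move=> y y0; apply: xXs; exact: hsup.
Qed.

End UniformBounds.

(** * Vanishing of a ground state *)

(** The potential and the ramp absorb at most [c / 2 * S ^+ 2 * M + K / 4] of the gain
    [c * S ^+ 2 * M + K / 2]; what remains must vanish. *)
Lemma core_vanishing_arith (R : realType) (c C S M K c2 P L e : R) : 0 < S ->
  0 < c -> 0 <= C -> 0 <= M -> 0 <= K -> 0 <= c2 ->
  c * S ^+ 2 <= L <= C * S ^+ 2 ->
  P <= c / 4 * S ^+ 2 * M -> 
  c2 <= e * (2 * S * M + 18 * K / S) ->
  0 < e -> 18 * e * (2^-1 + C) <= c / 4 -> 18 * e * (2^-1 + C) <= 1 / 4 ->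
  (M - S^-1 * c2) * L + K / 2 <= P + c2 / (2 * S^-1) ->
  M = 0 /\ K = 0.
Proof.
move=> S0 c0 C0 M0 K0 c20 /andP[L1 L2] PM c2e e0 ec e1 H.
have S20 : 0 < S ^+ 2 by rewrite exprn_gt0.
have Sc2 : S * c2 <= 18 * e * (S ^+ 2 * M + K).
  have -> : 18 * e * (S ^+ 2 * M + K) =
      S * (e * (18 * S * M + 18 * K / S)) by field; rewrite gt_eqF.
  rewrite ler_pM2l//; apply: le_trans c2e _; rewrite ler_pM2l// lerD2r.
  by rewrite ler_wpM2r// ler_wpM2r ?(ltW S0)// ler_nat.
have SM0 : 0 <= S ^+ 2 * M by rewrite mulr_ge0// ltW.
have Sc20 : 0 <= S * c2 by rewrite mulr_ge0// ltW.
have h1 : c * (S ^+ 2 * M) <= M * L.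
  by rewrite mulrA mulrC ler_wpM2l.
have h2 : S^-1 * c2 * L <= C * (S * c2).
  have -> : C * (S * c2) = S^-1 * c2 * (C * S ^+ 2) by field; rewrite gt_eqF.
  by rewrite ler_wpM2l// mulr_ge0// invr_ge0 ltW.
have h3 : c2 / (2 * S^-1) = 2^-1 * (S * c2) by field; rewrite gt_eqF.
have h4 : (2^-1 + C) * (S * c2) <= c / 4 * (S ^+ 2 * M) + 1 / 4 * K.
  apply: (@le_trans _ _ (18 * e * (2^-1 + C) * (S ^+ 2 * M + K))).
    have -> : 18 * e * (2^-1 + C) * (S ^+ 2 * M + K) =
      (2^-1 + C) * (18 * e * (S ^+ 2 * M + K)) by ring.
    by rewrite ler_wpM2l// addr_ge0.
  by rewrite mulrDr lerD// ler_wpM2r.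
rewrite h3 mulrBl in H; rewrite -mulrA in PM; rewrite mulrDl in h4.
move: (M * L) (S^-1 * c2 * L) (C * (S * c2)) H h1 h2 h4 => y1 y2 y3 H h1 h2 h4.
move: (S * c2) H h4 => z H h4.
have cM : c * (S ^+ 2 * M) / 2 + K / 4 <= 0.
  by move: (S ^+ 2 * M) PM h1 h4 => w PM h1 h4; clear -PM h1 h2 h4 H; lra.
have cM0 : 0 <= c * (S ^+ 2 * M) by rewrite mulr_ge0// ltW.
have KE : K = 0 by clear -cM cM0 K0; lra.
have cME : c * (S ^+ 2 * M) = 0 by clear -cM cM0 K0; lra.
split => //; move/eqP: cME; rewrite mulf_eq0 (gt_eqF c0)/= mulf_eq0 (gt_eqF S20)/=.
by move/eqP.
Qed.

(** The ramp costs [k / 4] and the other terms [k / 8], short of the [k / 2] gained. *)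
Lemma tail_vanishing_arith (R : realType) (k y1 y2 y3 y4 y5 y : R) :
  0 <= k -> 0 <= y1 -> y2 <= y4 -> y3 <= k / 4 -> y5 + y4 <= k / 8 -> y <= y5 ->
  y1 - y2 + k / 2 <= y + y3 -> k = 0.
Proof. lra. Qed.

Section Vanishing.
Variables (R : realType) (p c X : R).
Hypothesis p26 : 2 < p < 6.
Hypothesis c0 : 0 < c.
Hypothesis X1 : 1 <= X.
Variables (G : mgraph R) (m : R) (u : gfun G).
Hypothesis G_valid : valid_graph G.
Hypothesis core_gt0 : 0 < core_length G.
Hypothesis m0 : 0 < m.
Hypothesis u_gs : ground_state p m u.
Local Notation s := (m `^ beta p).
Local Notation sq := (fun t : R => t ^+ 2).
Local Notation pw := (fun t : R => `|t| `^ p).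
Local Notation r := ((p - 2) / 2).
Notation mu := (@lebesgue_measure R).
Local Notation C := ((4 * X) `^ r / 2).
Local Notation Lam a :=
  (- energy p u + (p - 2) / 2 * (tail_int a (fun t : R => `|t| `^ p) (fh u) / p)).
Hypothesis Ec : energy p u <= - (c * (m * s ^+ 2)).
Hypothesis kX : gint (G := G) sq (de u) (dh u) <= X ^+ 2 * (m * s ^+ 2).
Hypothesis cX : forall x, kpoint (G := G) x -> fe u x.1 x.2 ^+ 2 <= 4 * X * (m * s).
Hypothesis hX : forall x, 0 <= x -> fh u x ^+ 2 <= 4 * X * (m * s).

Lemma p_gt2 : 2 < p. Proof. by case/andP: p26. Qed.
Lemma p_pos : 0 < p. Proof. exact: lt_trans p_gt2. Qed.
Lemma s_pos : 0 < s. Proof. exact: powR_gt0. Qed.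

Lemma tail_pw_le a : 0 <= a -> tail_int a pw (fh u) <= tail_int 0 pw (fh u).
Proof.
move=> a0; have [ip _] := H1_halfline_pw p_gt2 u_gs.1.1.2.2.
by rewrite [leRHS](tail_int_split a0 ip) lerDr pw_ge0.
Qed.

(** From below, [Lam a >= - energy p u]. From above, with [P] the whole potential integral,
    [- energy p u <= P / p] and the tail is at most [P], so [Lam a <= P / 2]. Both bounds are
    uniform in [a]. *)
Lemma multiplier_bounds a : 0 <= a ->
  c * s ^+ 2 <= Lam a / m <= C * s ^+ 2.
Proof.
move=> a0; have p0 := p_pos; have p2 := p_gt2.
have P0 : 0 <= core_int pw (fe u).
  by apply: sumr_ge0 => e _; exact: pw_ge0.
have pP : tail_int a pw (fh u) <= gint (G := G) pw (fe u) (fh u).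
  by rewrite gintE (le_trans (tail_pw_le a0))// lerDr.
have Pub : gint (G := G) pw (fe u) (fh u) <= (4 * X) `^ r * s ^+ 2 * m.
  have := gint_pw_le p26 G_valid u_gs.1.1 cX hX; rewrite u_gs.1.2.
  rewrite powRM ?powR_mass_scale// ?mulr_ge0 ?(ltW m0) ?powR_ge0//.
  exact: le_trans X1.
have t0 : 0 <= tail_int a pw (fh u) by exact: pw_ge0.
have k0 : 0 <= gint (G := G) sq (de u) (dh u).
  by rewrite gintE addr_ge0// ?core_int_sq_ge0// tail_int_sq_ge0.
have E2 : - energy p u <= p^-1 * gint (G := G) pw (fe u) (fh u).
  by rewrite /energy opprB lerBlDr lerDl mulr_ge0.
have q0 : 0 <= (p - 2) / 2 by rewrite divr_ge0// subr_ge0 ltW.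
rewrite ler_pdivlMr// ler_pdivrMr//; apply/andP; split.
  apply: (@le_trans _ _ (- energy p u)).
    by rewrite lerNr (le_trans Ec)// lerN2 mulrAC mulrA.
  by rewrite lerDl mulr_ge0// divr_ge0// ltW.
apply: (@le_trans _ _ (2^-1 * gint (G := G) pw (fe u) (fh u))); last first.
  have -> : (4 * X) `^ r / 2 * s ^+ 2 * m = 2^-1 * ((4 * X) `^ r * s ^+ 2 * m) by ring.
  by rewrite ler_pM2l// invr_gt0.
have -> : 2^-1 * gint (G := G) pw (fe u) (fh u) = p^-1 * gint (G := G) pw (fe u) (fh u) +
   (p - 2) / 2 * (gint (G := G) pw (fe u) (fh u) / p).
  by field; rewrite gt_eqF.
rewrite lerD// ler_wpM2l// ler_pM2r// invr_gt0//.
Qed.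

Lemma core_vanishing e : 0 < e -> (e * (2 + 18 * X ^+ 2)) `^ r <= c / 4 ->
  18 * e * (2^-1 + C) <= c / 4 -> 18 * e * (2^-1 + C) <= 1 / 4 ->
  s * core_diam G < e -> (s * core_length G)^-1 < e ->
  [/\ core_int sq (fe u) = 0, core_int sq (de u) = 0 & fh u 0 = 0].
Proof.
move=> e0 ep ec e1 De le_.
have s0 := s_pos; have p0 := p_pos; have p2 := p_gt2.
have u_H1 := u_gs.1.1.
have M0 := core_int_sq_ge0 (fe u); have K0 := core_int_sq_ge0 (de u).
have Mm : core_int sq (fe u) <= m.
  by rewrite -u_gs.1.2 /mass gintE lerDl tail_int_sq_ge0.
have Kk : core_int sq (de u) <= X ^+ 2 * (m * s ^+ 2).
  by apply: le_trans kX; rewrite gintE lerDl tail_int_sq_ge0.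
(* The large length controls the mass term, the small diameter the kinetic one. *)
have bnd : 2 * core_int sq (fe u) / core_length G + 18 * (core_diam G * core_int sq (de u))
    <= e * (2 * s * core_int sq (fe u) + 18 * core_int sq (de u) / s).
  have -> : e * (2 * s * core_int sq (fe u) + 18 * core_int sq (de u) / s) =
    2 * core_int sq (fe u) * (e * s) + 18 * (e / s * core_int sq (de u)).
    by field; rewrite gt_eqF.
  apply: lerD.
    rewrite ler_wpM2l ?mulr_ge0//.
    by move: le_; rewrite invfM mulrC ltr_pdivrMr// => /ltW.
  rewrite ler_pM2l// ler_wpM2r// ler_pdivlMr// mulrC; exact: ltW.
have ms0 : 0 < m * s by rewrite mulr_gt0.
have bnd2 : e * (2 * s * core_int sq (fe u) + 18 * core_int sq (de u) / s) <=
    e * (2 + 18 * X ^+ 2) * (m * s).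
  have -> : e * (2 + 18 * X ^+ 2) * (m * s) =
      e * (2 * s * m + 18 * (X ^+ 2 * (m * s ^+ 2)) / s) by field; rewrite gt_eqF.
  rewrite ler_pM2l//; apply: lerD; first by rewrite ler_wpM2l// mulr_ge0// ltW.
  by rewrite ler_wpM2r ?invr_ge0 ?(ltW s0)// ler_wpM2l.
have core_le x : kpoint (G := G) x -> fe u x.1 x.2 ^+ 2 <= e * (2 + 18 * X ^+ 2) * (m * s).
  by move=> kx; apply: le_trans (core_sup G_valid core_gt0 u_H1 kx) (le_trans bnd bnd2).
have PK : core_int pw (fe u) <= c / 4 * s ^+ 2 * core_int sq (fe u).
  apply: le_trans (core_powR_norm_le G_valid u_H1 p2 core_le) _.
  have X20 : 0 <= 2 + 18 * X ^+ 2 by rewrite addr_ge0// mulr_ge0// sqr_ge0.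
  rewrite powRM ?powR_mass_scale ?(ltW ms0)//; last by rewrite mulr_ge0// ltW.
  by rewrite ler_wpM2r// ler_wpM2r// sqr_ge0.
have hs := le_trans (tail0_sup G_valid core_gt0 u_H1) bnd.
have /andP[L1 L2] := multiplier_bounds (lexx 0).
have L0 : 0 <= Lam 0.
  have : 0 <= Lam 0 / m.
    by apply: le_trans L1; rewrite mulr_ge0 ?sqr_ge0// ltW.
  by rewrite pmulr_lge0// invr_gt0.
(* With this ramp length, the mass of the ramp, priced at order [s^2], and its kinetic energy both
   cost of order [s * fh u 0 ^+ 2]. *)
have si0 : 0 < s^-1 by rewrite invr_gt0.
have := ground_state_cut p2 m0 u_gs (lexx 0) si0 L0.
rewrite !set_itv1 !Rintegral_set1 !addr0 => H.
have P0 : 0 <= core_int pw (fe u) by apply: sumr_ge0 => x _; exact: pw_ge0.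
have PKp : core_int pw (fe u) / p <= core_int pw (fe u).
  by rewrite ler_pdivrMr// ler_peMr// ltW// (lt_trans _ p2)// ltr1n.
have [] := @core_vanishing_arith R c C s (core_int sq (fe u)) (core_int sq (de u)) (fh u 0 ^+ 2)
  (core_int pw (fe u)) (Lam 0 / m) e => //.
- by rewrite divr_ge0// powR_ge0.
- exact: sqr_ge0.
- by rewrite L1.
- by apply: le_trans H _; rewrite lerD2r.
move=> ME KE; split => //.
move: hs; rewrite ME KE !mulr0 mul0r addr0 mulr0 => hs.
by apply/eqP; rewrite -sqrf_eq0 eq_le hs sqr_ge0.
Qed.

Hypothesis M_0 : core_int sq (fe u) = 0.
Hypothesis K_0 : core_int sq (de u) = 0.

Lemma core_pw0 : core_int pw (fe u) = 0.
Proof.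
apply/eqP; rewrite eq_le; apply/andP; split.
  have := core_powR_norm_le G_valid u_gs.1.1 p_gt2 cX.
  by rewrite M_0 mulr0.
by apply: sumr_ge0 => e _; exact: pw_ge0.
Qed.

(* With a ramp of length [2 b], the kinetic energy of the ramp at [a + b] is at
   most half of the one it replaces. *)
Lemma tail_vanishing_step : exists2 b, 0 < b & forall a, 0 <= a ->
  (forall x, 0 <= x <= a -> fh u x = 0) ->
  forall x, 0 <= x <= a + b -> fh u x = 0.
Proof.
have p0 := p_pos; have p2 := p_gt2; have s0 := s_pos.
have C0 : 0 <= C by rewrite divr_ge0// powR_ge0.
(* [Q] collects the potential lost per unit of mass and the price of the mass of the ramp. The
   choice of [b] below gives [b <= 1] and [b ^+ 2 * Q <= 1 / 8], independently of [a]. *)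
pose Q := (4 * X * (m * s)) `^ r + 2 * (C * s ^+ 2).
have Cs0 := mulr_ge0 C0 (sqr_ge0 s).
have Q0 : 0 <= Q by rewrite addr_ge0 ?powR_ge0// mulr_ge0.
pose b := (8 * (Q + 1))^-1.
have Q8 : 0 < 8 * (Q + 1) by rewrite mulr_gt0// ltr_wpDl.
have b0 : 0 < b by rewrite invr_gt0.
have b1 : b <= 1.
  rewrite invf_le1//; apply: (@le_trans _ _ (8 * 1)); first by rewrite mulr1 ler1n.
  by rewrite ler_pM2l// lerDr.
have bQ : b * (b * Q) <= 1 / 8.
  apply: (@le_trans _ _ (1 * (b * Q))).
    by rewrite ler_wpM2r// mulr_ge0// ltW.
  rewrite mul1r /b ler_pdivrMl//.
  by rewrite (_ : 8 * (Q + 1) * (1 / 8) = Q + 1) ?lerDl//; field.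
exists b => // a a0 ua.
have [H iu] := inH1_tail u_gs.1.1.
have [_ ig _] := H.
have ab0 : 0 <= a + b by rewrite addr_ge0// ltW.
pose k := \int[mu]_(x in `[0, a + b]) dh u x ^+ 2.
have sub : `[0, a + b] `<=` `[0, +oo[.
  by move=> x /=; rewrite !in_itv/= andbT => /andP[].
have k0 : 0 <= k by apply: Rintegral_ge0 => x _; exact: sqr_ge0.
(* A Poincare-type bound: [fh u] vanishes up to [a], and only a length [b] is left. Hence mass and
   potential on this piece are of order [b ^+ 2 * k]. *)
have ukb x : 0 <= x -> x <= a + b -> fh u x ^+ 2 <= b * k.
  move=> x0 xab; have [xa|/ltW ax] := leP x a.
    by rewrite ua ?x0// expr0n mulr_ge0// ltW.
  have sub2 : `[a, x] `<=` `[0, a + b].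
    move=> t /=; rewrite !in_itv/= => /andP[at_ tx].
    by rewrite (le_trans a0 at_) (le_trans tx xab).
  have h := H1on_osc (measurable_itv _) H ax (subset_trans sub2 sub).
  rewrite (ua a) ?a0 ?lexx// subr0 in h.
  apply: le_trans h _; apply: ler_pM.
  - by rewrite subr_ge0.
  - by apply: Rintegral_ge0 => t _; exact: sqr_ge0.
  - by rewrite lerBlDl.
  - by apply: le_Rintegral_set => //; [move=> t _; exact: sqr_ge0|exact: integrableS ig].
suff kE : k = 0.
  move=> x /andP[x0 xab]; have := ukb x x0 xab; rewrite kE mulr0 => h.
  by apply/eqP; rewrite -sqrf_eq0 eq_le h sqr_ge0.
pose M := \int[mu]_(x in `[0, a + b]) fh u x ^+ 2.
have M0 : 0 <= M by apply: Rintegral_ge0 => x _; exact: sqr_ge0.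
have ia : mu.-integrable `[0, a + b] (EFin \o (fun x => fh u x ^+ 2)).
  exact: integrableS iu.
have Mk : M <= b * (b * k).
  have ab : a <= a + b by rewrite lerDl ltW.
  have -> : M = 0 + \int[mu]_(x in `[a, a + b]) fh u x ^+ 2.
    rewrite /M (@Rintegral_split _ 0 a (BRight (a + b)))// ?bnd_simp//; congr (_ + _).
    rewrite /Rintegral integral0_eq// => x; rewrite /= in_itv/= => xa.
    by rewrite ua// expr0n.
  rewrite add0r (_ : b * (b * k) = b * k * (a + b - a)); last by ring.
  rewrite -Rintegral_itv_cst//.
  have sub2 : `[a, a + b] `<=` `[0, a + b].
    by move=> x /=; rewrite !in_itv/= => /andP[ax ->]; rewrite (le_trans a0 ax).
  apply: le_Rintegral => //; [exact: integrableS ia|exact: integrable_itv_cst|].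
  move=> x /=; rewrite in_itv/= => /andP[ax xab].
  by apply: ukb => //; exact: le_trans ax.
have Pk : \int[mu]_(x in `[0, a + b]) `|fh u x| `^ p <= (4 * X * (m * s)) `^ r * M.
  apply: (integrable_powR_norm p2 _ _ ia _).2 => //.
    exact: (H1on_itv_measurable _ H).
  by move=> x; rewrite /= in_itv/= => /andP[x0 _]; exact: hX.
have /andP[L1 L2] := multiplier_bounds ab0.
have L0 : 0 <= Lam (a + b).
  have : 0 <= Lam (a + b) / m.
    by apply: le_trans L1; rewrite mulr_ge0 ?sqr_ge0// ltW.
  by rewrite pmulr_lge0// invr_gt0.
have b20 : 0 < 2 * b by rewrite mulr_gt0.
have := ground_state_cut p2 m0 u_gs ab0 b20 L0.
rewrite M_0 K_0 core_pw0 !add0r -/M -/k.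
have cb := ukb (a + b) ab0 (lexx _).
have L1' : 0 <= Lam (a + b) / m.
  by rewrite divr_ge0// ltW.
have Pp : (\int[mu]_(x in `[0, a + b]) `|fh u x| `^ p) / p <=
    (4 * X * (m * s)) `^ r * (b * (b * k)).
  apply: (@le_trans _ _ (\int[mu]_(x in `[0, a + b]) `|fh u x| `^ p)).
    by rewrite ler_pdivrMr// ler_peMr ?pw_ge0// ltW// (lt_trans _ p2)// ltr1n.
  by apply: le_trans Pk _; rewrite ler_wpM2l// powR_ge0.
have cc0 := sqr_ge0 (fh u (a + b)).
move: (_ / m) L2 L1' Pp cb cc0 => L L2 L1' Pp cb cc0.
move: (_ / p) (fh u (a + b) ^+ 2) Pp cb cc0 => P d Pp db d0 H1.
have h1 : 2 * b * d * L <= b * (b * k) * (2 * (C * s ^+ 2)).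
  have -> : b * (b * k) * (2 * (C * s ^+ 2)) = 2 * b * (b * k) * (C * s ^+ 2) by ring.
  by apply: ler_pM => //; [rewrite mulr_ge0// ltW|rewrite ler_pM2l].
have h2 : d / (2 * (2 * b)) <= k / 4.
  have -> : d / (2 * (2 * b)) = d / b / 4 by field; rewrite gt_eqF.
  by rewrite ler_pM2r// ler_pdivrMr// mulrC.
have h3 : (4 * X * (m * s)) `^ r * (b * (b * k)) + b * (b * k) * (2 * (C * s ^+ 2)) <= k / 8.
  have -> : (4 * X * (m * s)) `^ r * (b * (b * k)) + b * (b * k) * (2 * (C * s ^+ 2)) =
    b * (b * Q) * k by rewrite /Q; ring.
  have -> : k / 8 = 1 / 8 * k by ring.
  by rewrite ler_wpM2r.
have ML : 0 <= M * L by rewrite mulr_ge0.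
rewrite mulrBl in H1.
exact: tail_vanishing_arith k0 ML h1 h2 h3 Pp H1.
Qed.

Hypothesis h_0 : fh u 0 = 0.

Lemma no_ground_state : False.
Proof.
have [b b0 step] := tail_vanishing_step.
have zero n x : 0 <= x <= b *+ n -> fh u x = 0.
  elim: n x => [|n IHn] x.
    by rewrite mulr0n -eq_le => /eqP <-.
  by rewrite mulrSr; apply: step => //; rewrite mulrn_wge0// ltW.
have hz x : 0 <= x -> fh u x = 0.
  move=> x0; apply: (zero (Num.Def.archi_bound (x / b))); rewrite x0/=.
  rewrite -mulr_natr -ler_pdivrMl// mulrC; apply/ltW/archi_boundP.
  by rewrite divr_ge0// ltW.
have : mass u = 0.
  rewrite /mass gintE M_0 add0r /tail_int /Rintegral integral0_eq// => x.
  by rewrite /= in_itv/= andbT => x0; rewrite hz// expr0n.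
by rewrite u_gs.1.2 => mE; move: m0; rewrite mE ltxx.
Qed.

End Vanishing.

Theorem theorem5p1 (R : realType) (p : R) :
  2 < p < 6 ->
  exists eps : R, 0 < eps /\
    forall (G : mgraph R) (mu : R),
      valid_graph G -> 0 < mu -> 0 < core_length G ->
      Num.max (mu `^ beta p * core_diam G) ((mu `^ beta p * core_length G)^-1) < eps ->
      ~ has_ground_state G p mu.
Proof.
move=> p26; have /andP[p2 p6] := p26.
have [c c0 Hc] := ground_state_energy_le p26.
have [X X1 HX] := apriori p26.
pose r := (p - 2) / 2; pose C := (4 * X) `^ r / 2.
have r0 : 0 < r by rewrite divr_gt0// subr_gt0.
have C0 : 0 < 2^-1 + C by rewrite ltr_wpDr ?invr_gt0// divr_ge0// powR_ge0.
have A0 : 0 < 2 + 18 * X ^+ 2 by rewrite ltr_wpDr// mulr_ge0// sqr_ge0.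
(* [e1] solves the power condition of [core_vanishing] and [e2] its two linear ones; both depend on
   [p] alone, through [c] and [X]. *)
pose e1 := (c / 4) `^ r^-1 / (2 + 18 * X ^+ 2).
pose e2 := Num.min c 1 / 4 / (18 * (2^-1 + C)).
have c40 : 0 < c / 4 by rewrite divr_gt0.
have D0 : 0 < 18 * (2^-1 + C) by rewrite mulr_gt0.
have e10 : 0 < e1 by rewrite divr_gt0// powR_gt0.
have e20 : 0 < e2 by rewrite !divr_gt0// lt_min c0 ltr01.
pose e := Num.min e1 e2.
have e0 : 0 < e by rewrite lt_min e10.
have ep : (e * (2 + 18 * X ^+ 2)) `^ r <= c / 4.
  have -> : c / 4 = ((c / 4) `^ r^-1) `^ r.
    by rewrite -powRrM mulVf ?gt_eqF// powRr1// ltW.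
  have eA := ltW (mulr_gt0 e0 A0).
  apply: (ge0_ler_powR (ltW r0)); rewrite ?nnegrE ?powR_ge0//.
  by rewrite -ler_pdivlMr// ge_min lexx.
have e2le : 18 * e * (2^-1 + C) <= Num.min c 1 / 4.
  have -> : 18 * e * (2^-1 + C) = e * (18 * (2^-1 + C)) by ring.
  by rewrite -ler_pdivlMr// ge_min lexx orbT.
have ec : 18 * e * (2^-1 + C) <= c / 4.
  by apply: le_trans e2le _; rewrite ler_pM2r ?invr_gt0// ge_min lexx.
have e1' : 18 * e * (2^-1 + C) <= 1 / 4.
  by apply: le_trans e2le _; rewrite ler_pM2r ?invr_gt0// ge_min lexx orbT.
exists e; split => // G m G_valid m0 core_gt0; rewrite gt_max => /andP[De le_] [u u_gs].
have Ec := Hc G m u G_valid m0 u_gs.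
have E0 : energy p u <= 0.
  by apply: le_trans Ec _; rewrite oppr_le0 mulr_ge0 ?(ltW c0)// mulr_ge0 ?(ltW m0)// sqr_ge0.
have [kX cX hX] := HX G m u G_valid m0 u_gs E0.
have [M_0 K_0 h_0] := core_vanishing p26 c0 X1 G_valid core_gt0 m0 u_gs Ec kX cX hX
  e0 ep ec e1' De le_.
exact: (no_ground_state p26 c0 X1 G_valid m0 u_gs Ec cX hX M_0 K_0 h_0).
Qed.
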